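(* Suppose $n_i\ge2$ for all $i=1,\ldots,g$. Every standard divisor $D_{\mathfrak d_i,z_j}$ on $E^g$ of type $(n_1,\ldots,n_g)$ is base-point free or, equivalently, $\mathcal O_{E^g}(D_{\mathfrak d_i,z_j})$ is generated by its global sections. In particular, for relatively prime integers $n>k\ge1$, $D_{n/k}$ is base-point free and $\mathcal L_{n/k}$ is generated by its global sections.
   Context: $E=\mathbb C/\Lambda$ is a complex elliptic curve with identity $0$, $g\ge1$. For divisors $\mathfrak d_1,\ldots,\mathfrak d_g$ on $E$ and points $z_1,\ldots,z_{g-1}\in E$, put $$D_{\mathfrak d_i,z_j}=\sum_{i=1}^g\mathrm{pr}_i^*(\mathfrak d_i)+\sum_{j=1}^{g-1}\Delta^{z_j}_{j,j+1},\qquad \Delta^z_{j,j+1}=\{(x_1,\ldots,x_g)\in E^g\mid x_{j+1}=x_j+z\},$$ where $\mathrm{pr}_i:E^g\to E$ is the $i$-th projection. If all $\mathfrak d_i$ are effective, $D_{\mathfrak d_i,z_j}$ is called a standard divisor; its type is $(n_1,\ldots,n_g)$ where $n_i=\deg\mathfrak d_i+2-\delta_{i,1}-\delta_{i,g}$. $[n_1,\ldots,n_g]=n_1-\cfrac{1}{n_2-\cfrac{1}{\ddots-\cfrac1{n_g}}}$; each $\frac nk$ with $n>k\ge1$ coprime has a unique expansion $\frac nk=[n_1,\ldots,n_g]$ with $g\ge1$ and all $n_i\ge2$. $\mathcal L_{n/k}=\mathcal O_{E^g}(D_{n/k})$, where $D_{n/k}$ is the standard divisor on $E^g$ with $\mathfrak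 d_i=(n_i-2+\delta_{i,1}+\delta_{i,g})(0)$ and all $z_j=0$. *)

(* Defs.v *)
From HB Require Import structures.
From mathcomp Require Import all_boot all_order all_algebra.
From mathcomp Require Import generic_quotient ring_quotient complex freeg.
From mathcomp Require Import all_classical all_reals all_analysis.
From mathcomp Require Import ring lra zify.

Set Implicit Arguments.
Unset Strict Implicit.
Unset Printing Implicit Defensive.

Import Order.TTheory GRing.Theory Num.Theory numFieldNormedType.Exports.

Local Open Scope classical_set_scope.
Local Open Scope ring_scope.
Local Open Scope quotient_scope.

(* The complex numbers are [R[i]], viewed as an
   abstract [numClosedFieldType] so that they carry the norm topology and
   [differentiable] means complex (Frechet) differentiable. *)
Definition Cplx (R : realType) : numClosedFieldType := R[i]%C.

Definition is_lattice (R : realType) (L : zmodClosed (Cplx R)) : Prop :=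
  exists w1 w2 : Cplx R,
    (forall s t : R, (s%:C)%C * w1 + (t%:C)%C * w2 = 0 :> Cplx R ->
       s = 0 /\ t = 0) /\
    (forall u : Cplx R, u \in L <-> exists m n : int, u = w1 *~ m + w2 *~ n).

Notation curve L := (ring_quotient.Quotient.quot L).

(* Germs at a point of C^g are represented by total functions.  A meromorphic
   germ is represented by any function with the right values on a dense open
   set: its values elsewhere (in particular at poles, where division returns a
   default value) are irrelevant, since meromorphic germs are compared with
   [eq_germ] only. *)
Section Germs.
Variables (R : realType) (g : nat).
Local Notation C := (Cplx R).
Local Notation V := 'rV[C]_g.
Implicit Types (a v w : V) (f h p q : V -> C).

Definition holomorphic_at a f : Prop := \forall v \near a, differentiable f v.

Definition eq_germ a f h : Prop :=
  \forall v \near a, closure ([set w | f w = h w]°) v.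

(* For holomorphic [q]: the germ of [q] at [a] is a nonzerodivisor, that is,
   [q] vanishes on no nonempty open set near [a]. *)
Definition nonzero_germ a q : Prop :=
  \forall v \near a, closure [set w | q w != 0] v.

Definition regular_at a f : Prop :=
  exists2 h, holomorphic_at a h & eq_germ a f h.

Definition unit_at a f : Prop :=
  exists2 h, holomorphic_at a h /\ h a != 0 & eq_germ a f h.

Definition meromorphic_nonzero_at a f : Prop :=
  exists p q, [/\ holomorphic_at a p, holomorphic_at a q, nonzero_germ a p,
                  nonzero_germ a q & eq_germ a f (fun v => p v / q v)].

End Germs.

Section Torus.
Variables (R : realType) (L : zmodClosed (Cplx R)) (g : nat).
Local Notation C := (Cplx R).
Local Notation E := (curve L).
Local Notation V := 'rV[C]_g.

(* E^g is ['rV[E]_g]; its complex charts are the local inverses of the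
   projection below.  "The chart at a" is the one near [a : V], and germs on
   E^g at [tproj a] are read in it as germs on C^g at [a]. *)
Local Notation X := 'rV[E]_g.

Definition tproj (a : V) : X := map_mx (\pi_E) a.

(* Cartier divisors: [D a] is a local equation at the point [tproj a], read in
   the chart at [a]. *)
Definition cartier_data := V -> V -> C.

Implicit Types D : cartier_data.

(* Local equations agree up to units: between the charts at nearby points, and
   between the charts at two lifts of the same point of E^g. *)
Definition is_divisor D : Prop :=
  [/\ forall a, meromorphic_nonzero_at a (D a),
      forall a, \forall b \near a, unit_at b (fun v => D a v / D b v)
    & forall a b, tproj a = tproj b ->
        unit_at a (fun v => D a v / D b (v + (b - a)))].

Definition effective D : Prop := forall a, regular_at a (D a).

Definition support D : set X :=
  [set x | exists2 a, tproj a = x & ~ unit_at a (D a)].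

(* [D'] = [D] + div(f) for some nonzero meromorphic function [f] on E^g. *)
Definition linearly_equivalent D D' : Prop :=
  exists f : X -> C,
    (forall a, meromorphic_nonzero_at a (f \o tproj)) /\
    (forall a, unit_at a (fun v => D' a v / (D a v * f (tproj v)))).

Definition linear_system D : set cartier_data :=
  [set D' : cartier_data | [/\ is_divisor D', effective D' & linearly_equivalent D D']].

Definition base_point_free D : Prop :=
  forall x : X, exists2 D', linear_system D D' & ~ support D' x.

(* The stalk of O(D) at [tproj a], and the sections of O(D) over [U]: the
   meromorphic functions s with div(s) + D >= 0. *)
Definition OD_stalk D (a : V) : set (V -> C) :=
  [set t : V -> C | regular_at a (fun v => t v * D a v)].

Definition OD_sections D (U : set X) : set (X -> C) :=
  [set s : X -> C | forall a, U (tproj a) -> OD_stalk D a (s \o tproj)].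

Definition globally_generated D : Prop :=
  forall (a : V) (t : V -> C), OD_stalk D a t ->
    exists (k : nat) (s : 'I_k -> X -> C) (c : 'I_k -> V -> C),
      [/\ forall i, OD_sections D setT (s i),
          forall i, holomorphic_at a (c i)
        & eq_germ a t (fun v => \sum_(i < k) c i v * s i (tproj v))].

End Torus.

(* Here g = m.+1 >= 1; the indices j, j+1 (0 <= j < m) of [Delta] are
   [widen_ord (leqnSn m) j] and [fintype.lift ord0 j]. *)
Section StandardDivisors.
Variables (R : realType) (L : zmodClosed (Cplx R)) (m : nat).
Local Notation C := (Cplx R).
Local Notation E := (curve L).
Local Notation V := 'rV[C]_m.+1.
Local Notation X := 'rV[E]_m.+1.

(* On E, (t - c) ^ (multiplicity of d at the class of c) is a local equation
   of d at the class of c; it is composed here with the projection. *)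
Definition pr_pullback (i : 'I_m.+1) (d : {freeg E}) : cartier_data R m.+1 :=
  fun a v => (v 0 i - a 0 i) ^ coeff (\pi_E (a 0 i)) d.

Definition Delta (j : 'I_m) (z : E) : set X :=
  [set x : X | x 0 (fintype.lift ord0 j) = x 0 (widen_ord (leqnSn m) j) + z].

(* The reduced divisor [Delta j z]: in the chart at a point of [Delta j z], it
   is given by the constancy of the difference of the two coordinates. *)
Definition Delta_div (j : 'I_m) (z : E) : cartier_data R m.+1 :=
  fun a v =>
    if tproj L a \in Delta j z then
      (v 0 (fintype.lift ord0 j) - v 0 (widen_ord (leqnSn m) j))
      - (a 0 (fintype.lift ord0 j) - a 0 (widen_ord (leqnSn m) j))
    else 1.

(* A sum of divisors is given by the products of the local equations. *)
Definition std_div (d : 'I_m.+1 -> {freeg E}) (z : 'I_m -> E) :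
    cartier_data R m.+1 :=
  fun a v => (\prod_(i < m.+1) pr_pullback i (d i) a v)
             * \prod_(j < m) Delta_div j (z j) a v.

Definition is_standard (d : 'I_m.+1 -> {freeg E}) : Prop :=
  forall i, fgle 0 (d i).

Definition std_type (d : 'I_m.+1 -> {freeg E}) : m.+1.-tuple int :=
  [tuple deg (d i) + 2 - (i == ord0)%:Z - (i == ord_max)%:Z | i < m.+1].

Definition cf_div (n : m.+1.-tuple int) : cartier_data R m.+1 :=
  std_div
    (fun i => << (tnth n i - 2 + (i == ord0)%:Z + (i == ord_max)%:Z) *g
                 (0 : E) >>)
    (fun _ => 0).

End StandardDivisors.

Arguments cf_div {R} L {m} n.

(* [n_1, ..., n_g] = n_1 - 1 / (n_2 - 1 / (... - 1 / n_g)); the innermost step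
   is n_g - 0^-1 = n_g. *)
Definition neg_cf (s : seq int) : rat := foldr (fun a x => a%:~R - x^-1) 0 s.

Definition is_expansion (n k : nat) (s : seq int) : Prop :=
  [/\ s != [::], all (fun a => 2 <= a) s & n%:R / k%:R = neg_cf s].

Lemma neg_cf_cons (a : int) (s : seq int) : neg_cf (a :: s) = a%:~R - (neg_cf s)^-1.
Proof. by []. Qed.

Lemma neg_cf_bounds (a : int) (s : seq int) : all (fun a => 2 <= a) (a :: s) ->
  a%:~R - 1 < neg_cf (a :: s) <= a%:~R.
Proof.
rewrite neg_cf_cons; elim: s a => [|b s IH] a /=.
  move=> _; rewrite invr0 subr0 lexx andbT; lra.
move=> /and3P[a2 b2 s2]; have := IH b; rewrite /= b2 s2 => /(_ isT).
set x := b%:~R - _^-1; move=> /andP[lo _].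
have b2' : (2 : rat) <= b%:~R by rewrite (ler_int _ 2 b).
have x1 : 1 < x by lra.
have xV0 : 0 < x^-1 by rewrite invr_gt0; lra.
have xV1 : x^-1 < 1 by rewrite invf_lt1 //; lra.
by apply/andP; split; lra.
Qed.

Lemma neg_cf_gt1 (a : int) (s : seq int) : all (fun a => 2 <= a) (a :: s) ->
  1 < neg_cf (a :: s).
Proof.
move=> as2; have /andP[lo _] := neg_cf_bounds as2.
have : (2 : rat) <= a%:~R by rewrite (ler_int _ 2); case/andP: as2.
lra.
Qed.

Lemma expansion_unique (n k : nat) s s' :
  is_expansion n k s -> is_expansion n k s' -> s = s'.
Proof.
case=> s0 s2 es [s'0 s'2]; rewrite es => {es n k}.
elim: s s0 s2 s' s'0 s'2 => [//|a s IH] _ s2 [//|b s'] _ s'2 e.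
have := neg_cf_bounds s2; have := neg_cf_bounds s'2; rewrite -e.
move=> /andP[b1 b2] /andP[a1 a2].
have ab : a = b.
  have h1 : (a - 1)%:~R < b%:~R :> rat by rewrite rmorphB; apply: lt_le_trans b2.
  have h2 : (b - 1)%:~R < a%:~R :> rat by rewrite rmorphB; apply: lt_le_trans a2.
  by move: h1 h2; rewrite !ltr_int; lia.
subst b; congr (_ :: _).
move: e; rewrite !neg_cf_cons => /addrI /oppr_inj /invr_inj e.
case: s s' IH s2 s'2 e {a1 a2 b1 b2} => [|c s] [|c' s'] IH //.
- by move=> _ /andP[_ s'2] e; have := neg_cf_gt1 s'2; rewrite -e ltr10.
- by move=> /andP[_ s2] _ e; have := neg_cf_gt1 s2; rewrite e ltr10.
move=> /andP[_ s2] /andP[_ s'2] e; exact: IH.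
Qed.

Lemma expansion_exists (n k : nat) : (1 <= k)%N -> (k < n)%N -> coprime n k ->
  exists s, is_expansion n k s.
Proof.
elim/ltn_ind: k n => k IH n k1 kn cop.
have kE : (k%:R : rat) != 0 by rewrite pnatr_eq0 -lt0n.
have [k_eq1|k_neq1] := eqVneq k 1%N.
  exists [:: n%:Z]; split => //=.
    by rewrite andbT; lia.
  by rewrite k_eq1 divr1 invr0 subr0 -pmulrn.
have r0 : (0 < n %% k)%N.
  rewrite lt0n; apply/negP => /eqP nk0.
  by move: cop; rewrite coprime_sym /coprime (gcdn_idPl _) ?(negPf k_neq1) // /dvdn nk0.
have rk : (n %% k < k)%N by rewrite ltn_mod.
have copr : coprime k (k - n %% k).
  have : coprime k (n %% k) by rewrite coprime_modr coprime_sym.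
  have aux q r : coprime (q + r) r -> coprime (q + r) q.
    by rewrite /coprime gcdnC gcdnDr [gcdn (q + r) q]gcdnC gcdnDl gcdnC.
  by have := aux (k - n %% k)%N (n %% k)%N; rewrite subnK ?(ltnW rk) //; apply.
have [|||s [s0 s2 es]] := IH (k - n %% k)%N _ k _ _ copr; [lia..|].
exists ((n %/ k).+1%:Z :: s); split => //=.
  rewrite s2 andbT; have : (0 < n %/ k)%N by rewrite divn_gt0 //; lia.
  by lia.
rewrite -es invf_div natrB ?(ltnW rk) //.
rewrite {1}(divn_eq n k) natrD natrM -pmulrn -natr1.
by field.
Qed.

(* Main.v *)
Require Import Defs.
From HB Require Import structures.
From mathcomp Require Import all_boot all_order all_algebra.
From mathcomp Require Import generic_quotient ring_quotient complex freeg.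
From mathcomp Require Import all_classical all_reals all_analysis.
From mathcomp Require Import ring lra zify.
Import Order.TTheory GRing.Theory Num.Theory numFieldNormedType.Exports.
Local Open Scope ring_scope.

Set Implicit Arguments.
Unset Strict Implicit.
Unset Printing Implicit Defensive.

(** The divisors in question are cut out by theta functions on [C^g], and these
    can be moved in their linear equivalence class as soon as a certain linear
    relation with nonzero integral coefficients exists.

    On [C] there is a sigma function: an entire function [S] with simple zeros at
    the points of the lattice and no others, such that
    [S (u + w) = A_w * exp (kappa w * u) * S u] for every period [w], with [kappa]
    additive ([sigma_function_exists]).  A standard divisor is a sum of pullbacks
    of points [p k] of [E] under linear forms [l k], each of them a coordinate or
    a difference of consecutive coordinates.  Hence
    [theta p v = \prod_k S (l k v - p k)] is a global equation of its inverse image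
    in [C^g] ([theta_local], [std_div_local_eq]).

    Suppose that integers [r k] satisfy [\sum_k r k * l k = 0].  Replacing each
    [p k] by [p k + tau * r k] does not change the multipliers of [theta p], since
    [kappa] is additive.  The quotient of the two theta functions is then a
    meromorphic function on [E^g] ([theta_quotE]), and the translated divisor is
    linearly equivalent to the first one.  If moreover no [r k] is [0], then for
    small nonzero [tau] each component of the translated divisor misses a given
    point.  So the point is not a base point ([local_eq_base_point_free]), and the
    quotient, as a section of [O(D)], generates the stalk at that point
    ([local_eq_globally_generated]).

    What remains is to find such a relation among the coordinates [x_i], repeated
    [deg d_i] times, and the differences [x_(j+1) - x_j].  Here the hypothesis
    [n_i >= 2] enters: it says that [d_1] and [d_g] are nonzero if [g > 1], and that
    [deg d_1 >= 2] if [g = 1] ([standard_relation]).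

    The sigma function comes from Jacobi's triple product.  If [|q| < 1], the power
    series [F] with [F 0 = 1] and [F x = (1 - x) * F (q * x)] is entire, and iterating
    this equation shows that its zeros are the [q ^- k].  The function
    [F (e u) * F (q / e u)], where [e] is an exponential with period [w1] and
    [e w2 = q], is as required. *)

(** * The modulus and the convergence of complex series *)

Section ComplexNorm.
Variable R : realType.
Local Notation C := (Cplx R).
Local Notation Re := (@complex.Re R).
Local Notation Im := (@complex.Im R).
Implicit Types z w : C.

(** The norm of [C] has values in [C]; the same number is needed in [R], to compare
    with real series. *)
Definition rnorm z : R := Normc.normc z.

Lemma rnormE z : `|z| = (rnorm z)%:C%C :> C. Proof. by []. Qed.

Lemma rnorm_ge0 z : 0 <= rnorm z.
Proof. by have := normr_ge0 z; rewrite rnormE ler0c. Qed.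

Lemma rnormM z w : rnorm (z * w) = rnorm z * rnorm w.
Proof. exact: Normc.normcM. Qed.

Lemma rnorm0 : rnorm 0 = 0. Proof. exact: Normc.normc0. Qed.
Lemma rnorm1 : rnorm 1 = 1. Proof. exact: Normc.normc1. Qed.
Lemma rnormV z : rnorm z^-1 = (rnorm z)^-1. Proof. exact: Normc.normcV. Qed.

Lemma rnormX z n : rnorm (z ^+ n) = rnorm z ^+ n.
Proof. by elim: n => [|n IH]; rewrite ?expr0 ?rnorm1 // !exprS rnormM IH. Qed.

Lemma rnormD z w : rnorm (z + w) <= rnorm z + rnorm w.
Proof. exact: le_normcD. Qed.

Lemma rnormN z : rnorm (- z) = rnorm z.
Proof. exact: normcN. Qed.

Lemma rnorm_eq0 z : (rnorm z == 0) = (z == 0).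
Proof. by apply/eqP/eqP => [/Normc.eq0_normc|->//]; rewrite ?rnorm0. Qed.

Lemma rnorm_nat n : rnorm n%:R = n%:R.
Proof. 
have := normr_nat C n; rewrite rnormE -(rmorph_nat (real_complex R)).
by move/complexI.
Qed.

Lemma rnorm_real (x : R) : rnorm (x%:C)%C = `|x|.
Proof. by rewrite /rnorm/= expr0n addr0 sqrtr_sqr. Qed.

Lemma rnorm_sum I (r : seq I) (f : I -> C) :
  rnorm (\sum_(i <- r) f i) <= \sum_(i <- r) rnorm (f i).
Proof.
elim/big_rec2: _ => [|i x y _ h]; first by rewrite rnorm0.
by apply: (le_trans (rnormD _ _)); rewrite lerD2l.
Qed.

Lemma Re_rnorm z : `|Re z| <= rnorm z.
Proof.
by have := normc_ge_Re z; rewrite [X in _ <= X]rnormE lecR.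
Qed.

Lemma Im_rnorm z : `|Im z| <= rnorm z.
Proof.
have := Re_rnorm (z * 'i%C); rewrite ReiNIm normrN rnormM.
by rewrite {2}/rnorm /= expr0n expr1n add0r sqrtr1 mulr1.
Qed.

Lemma rnorm_le_ReIm z : rnorm z <= `|Re z| + `|Im z|.
Proof.
rewrite [z in rnorm z]complexE; apply: (le_trans (rnormD _ _)).
rewrite rnormM !rnorm_real.
by rewrite {1}/rnorm /= expr0n expr1n add0r sqrtr1 mul1r.
Qed.

Lemma ReD z w : Re (z + w) = Re z + Re w. Proof. by case: z w => [? ?] []. Qed.
Lemma ImD z w : Im (z + w) = Im z + Im w. Proof. by case: z w => [? ?] []. Qed.
Lemma ImN z : Im (- z) = - Im z. Proof. by case: z. Qed.

Lemma Re_sum n (f : nat -> C) :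
  Re (\sum_(0 <= i < n) f i) = \sum_(0 <= i < n) Re (f i).
Proof. by elim: n => [|n IH]; rewrite ?big_nil // !big_nat_recr//= ReD IH. Qed.
Lemma Im_sum n (f : nat -> C) :
  Im (\sum_(0 <= i < n) f i) = \sum_(0 <= i < n) Im (f i).
Proof. by elim: n => [|n IH]; rewrite ?big_nil // !big_nat_recr//= ImD IH. Qed.

Lemma cplx_gt0 (e : C) : 0 < e -> exists2 r : R, 0 < r & e = (r%:C)%C.
Proof.
case: e => [a b]; rewrite ltcE/= => /andP[/eqP -> a0]; by exists a.
Qed.

End ComplexNorm.

Section ComplexSeries.
Variable R : realType.
Local Notation C := (Cplx R).
Local Notation Re := (@complex.Re R).
Local Notation Im := (@complex.Im R).
Local Open Scope classical_set_scope.

Lemma cvg_ReIm (u : nat -> C) (x y : R) :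
  Re \o u @ \oo --> x -> Im \o u @ \oo --> y -> u @ \oo --> ((x +i* y)%C : C).
Proof.
move=> ux uy; apply/cvgrPdist_lt => e /cplx_gt0[r r0 ->].
have r2 : 0 < r / 2 by lra.
near=> n.
have nx : `|x - Re (u n)| < r / 2 by near: n; apply: cvgr_dist_lt.
have ny : `|y - Im (u n)| < r / 2 by near: n; apply: cvgr_dist_lt.
rewrite rnormE ltcR; apply: (le_lt_trans (rnorm_le_ReIm _)).
move: nx ny; case: (u n) => [a b] /=; lra.
Unshelve. all: by end_near. Qed.

Lemma cvg_rnorm_le (u : nat -> C) (s : C) (B : R) :
  u @ \oo --> s -> (forall n, rnorm (u n) <= B) -> rnorm s <= B.
Proof.
move=> us uB; rewrite leNgt; apply/negP => Bs.
have e0 : 0 < ((rnorm s - B)%:C)%C :> C by rewrite ltcR subr_gt0.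
move/cvgrPdist_lt: us => /(_ _ e0)[N _ /(_ N (leqnn N))]; rewrite rnormE ltcR.
have := uB N; have := rnormD (s - u N) (u N); rewrite subrK; lra.
Qed.

(** Domination by a convergent real series; completeness of the complex numbers
    enters through the real and imaginary parts. *)
Lemma dominated_series (a : nat -> C) (b : nat -> R) :
  (forall n, rnorm (a n) <= b n) -> cvgn (series b) ->
  cvgn (series a) /\ rnorm (limn (series a)) <= limn (series b).
Proof.
move=> ab cb.
have b0 n : 0 <= b n by apply: le_trans (ab n); apply: rnorm_ge0.
have part (f : C -> R) : (forall z, `|f z| <= rnorm z) ->
    cvgn (series (f \o a)).
  move=> fle; apply: normed_cvg; apply: series_le_cvg cb => //= n.
  exact: le_trans (fle _) (ab n).
have /cvg_ex[x cx] := part Re (@Re_rnorm R).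
have /cvg_ex[y cy] := part Im (@Im_rnorm R).
have cs : series a @ \oo --> ((x +i* y)%C : C).
  apply: cvg_ReIm.
    rewrite (_ : _ \o _ = series (Re \o a)) //; apply/funext => n /=.
    exact: Re_sum.
  rewrite (_ : _ \o _ = series (Im \o a)) //; apply/funext => n /=.
  exact: Im_sum.
split; first by apply/cvg_ex; exists (x +i* y)%C.
apply: (cvg_rnorm_le (u := series a)); first exact: (cvgP _ cs).
move=> n; apply: (le_trans (rnorm_sum _ _)).
apply: (@le_trans _ _ (series b n)); first exact: ler_sum.
apply: nondecreasing_cvgn_le => //.
by apply/nondecreasing_seqP => k; rewrite !seriesEnat /= big_nat_recr //= lerDl.
Qed.

End ComplexSeries.

(** * Power series with infinite radius of convergence *)

Section QuadraticRemainder.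
Variable K : numFieldType.

(** A quadratic bound on the remainder of a first order expansion needs no
    limit to be computed: it is how termwise differentiation is justified below. *)
Lemma quadratic_differentiable (f : K -> K) (x d M : K) : 0 <= M ->
  (forall y, `|y - x| <= 1 ->
     `|f y - f x - (y - x) * d| <= `|y - x| ^+ 2 * M) ->
  differentiable f x.
Proof.
move=> M0 fq; apply/derivable1_diffP/cvg_ex; exists d => /=.
apply/pseudometric_normed_Zmodule.cvgrPdist_lt => e e0.
have M1 : 0 < M + 1 by rewrite ltr_wpDl.
have eM : 0 < e / (M + 1) by rewrite divr_gt0.
near=> h.
have h0 : h != 0 by near: h; exact: nbhs_dnbhs_neq.
have h1 : `|h| < 1 by near: h; exact: dnbhs0_lt.
have hr : `|h| < e / (M + 1) by near: h; exact: dnbhs0_lt.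
have hE : (h *: 1 + x) - x = h by rewrite addrK [h *: 1]mulr1.
have := fq (h *: 1 + x); rewrite hE => /(_ (ltW h1)) q.
have -> : d - h^-1 *: (f (h *: 1 + x) - f x) =
    - (h^-1 * (f (h *: 1 + x) - f x - h * d)).
  by rewrite [h^-1 *: _]/(h^-1 * _) mulrBr mulKf // opprB.
have hn : 0 < `|h| by rewrite normr_gt0.
rewrite normrN normrM normfV mulrC ltr_pdivrMr //.
apply: (le_lt_trans q); rewrite expr2 -mulrA mulrC ltr_pM2r //.
apply: (@le_lt_trans _ _ (`|h| * (M + 1))).
  by rewrite ler_wpM2l // lerDl.
by rewrite -ltr_pdivlMr.
Unshelve. all: by end_near. Qed.

Local Open Scope classical_set_scope.

Lemma lim_series_recl (c : nat -> K) x :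
  cvgn (series (fun n => c n.+1 * x ^+ n)) ->
  limn (series (fun n => c n * x ^+ n)) =
  c 0%N + x * limn (series (fun n => c n.+1 * x ^+ n)).
Proof.
move=> cs; apply: cvg_lim; first exact: norm_hausdorff.
rewrite -cvg_shiftS /=.
rewrite (_ : (fun n => _) =
  (fun n => c 0%N + x * series (fun n => c n.+1 * x ^+ n) n)).
  by apply: cvgD; [exact: cvg_cst | apply: cvgMr].
apply/funext => n; rewrite !seriesEnat /= big_nat_recl // expr0 mulr1.
congr (_ + _); rewrite big_distrr /=; apply: eq_bigr => i _.
by rewrite exprS mulrCA.
Qed.

Lemma lim_series_remainder (a b d : nat -> K) (c : nat -> K) k :
  cvgn (series (fun n => c n * a n)) ->
  cvgn (series (fun n => c n * b n)) ->
  cvgn (series (fun n => c n * d n)) ->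
  limn (series (fun n => c n * (a n - b n - k * d n))) =
  limn (series (fun n => c n * a n)) - limn (series (fun n => c n * b n))
  - k * limn (series (fun n => c n * d n)).
Proof.
move=> ca cb cd; apply: cvg_lim; first exact: norm_hausdorff.
rewrite (_ : series _ = fun n => series (fun n => c n * a n) n
   - series (fun n => c n * b n) n - k * series (fun n => c n * d n) n).
  by apply: cvgB; [apply: cvgB | apply: cvgMr].
apply/funext => n; rewrite !seriesEnat /= big_distrr /= -!sumrB.
by apply: eq_bigr => i _; ring.
Qed.

End QuadraticRemainder.

Section PowerSeries.
Variable R : realType.
Local Notation C := (Cplx R).
Local Open Scope classical_set_scope.
Implicit Types (c : nat -> C) (x y : C).

(** Infinite radius of convergence, expressed as in Abel's lemma by bounded
    terms, which become summable at any smaller radius. *)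
Definition entire_coeffs c : Prop :=
  forall rho : R, 0 < rho ->
    exists M : R, forall n, rnorm (c n) * rho ^+ n <= M.

Lemma entire_coeffs_geometric c (rho : R) : entire_coeffs c -> 0 < rho ->
  exists M : R, forall n, rnorm (c n) * rho ^+ n <= geometric M (2^-1) n.
Proof.
move=> ec r0; have [|M cM] := ec (2 * rho); first lra.
exists M => n /=; have := cM n; rewrite exprMn mulrCA => h.
by rewrite exprVn ler_pdivlMr ?exprn_gt0 // mulrC.
Qed.

Lemma half_cvg (M : R) : cvgn (series (geometric M (2^-1))).
Proof. by apply: is_cvg_geometric_series; rewrite ger0_norm; lra. Qed.

Arguments half_cvg : clear implicits.

Definition psum c x : C := limn (series (fun n => c n * x ^+ n)).

Lemma entire_cvg c x : entire_coeffs c ->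
  cvgn (series (fun n => c n * x ^+ n)).
Proof.
move=> ec.
have [|M cM] := entire_coeffs_geometric (rho := rnorm x + 1) ec.
  by have := rnorm_ge0 x; lra.
suff /dominated_series /(_ (half_cvg M)) [] : forall n,
    rnorm (c n * x ^+ n) <= geometric M 2^-1 n by [].
move=> n.
apply: le_trans (cM n); rewrite rnormM rnormX ler_wpM2l ?rnorm_ge0 //.
by rewrite lerXn2r ?nnegrE ?addr_ge0 ?rnorm_ge0 // lerDl.
Qed.

Lemma entire_shift c : entire_coeffs c -> entire_coeffs (c \o S).
Proof.
move=> ec r r0; have [M cM] := ec r r0; exists (M / r) => n /=.
by rewrite ler_pdivlMr // -mulrA -exprSr.
Qed.

Lemma psum_recl c x : entire_coeffs c ->
  psum c x = c 0%N + x * psum (c \o S) x.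
Proof.
move=> ec; exact/lim_series_recl/entire_cvg/entire_shift.
Qed.

Lemma psum_at0 c : entire_coeffs c -> psum c 0 = c 0%N.
Proof. by move=> ec; rewrite psum_recl // mul0r addr0. Qed.

(** The remainder [e n] of [y ^+ n] at [x] satisfies
    [e n.+1 = y * e n + n * (y - x) ^+ 2 * x ^+ n.-1], and [n <= 2 ^ n]. *)
Lemma pow_remainder x y (rho : R) n :
  1 <= rho -> rnorm x <= rho -> rnorm y <= rho ->
  rnorm (y ^+ n - x ^+ n - (y - x) * (n%:R * x ^+ n.-1))
    <= rnorm (y - x) ^+ 2 * (2 * rho) ^+ n.
Proof.
move=> r1 xr yr; elim: n => [|n IH].
  by rewrite !expr0 subrr mul0r mulr0 subr0 rnorm0 mulr1 sqr_ge0.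
have e : y ^+ n.+1 - x ^+ n.+1 - (y - x) * (n.+1%:R * x ^+ n) =
    y * (y ^+ n - x ^+ n - (y - x) * (n%:R * x ^+ n.-1))
    + (y - x) ^+ 2 * (n%:R * x ^+ n.-1).
  case: n {IH} => [|n] /=; first by rewrite !expr0 !expr1; ring.
  by rewrite -(natr1 n.+1) !exprS; ring.
rewrite e; apply: (le_trans (rnormD _ _)); rewrite !rnormM !rnormX rnorm_nat.
set D := rnorm (y - x) ^+ 2; set p := (2 * rho) ^+ n.
have D0 : 0 <= D by apply: sqr_ge0.
have pow : n%:R * rnorm x ^+ n.-1 <= p.
  rewrite /p exprMn; apply: ler_pM => //.
  - by rewrite exprn_ge0 ?rnorm_ge0.
  - by rewrite -natrX ler_nat ltnW // ltn_expl.
  - apply: (@le_trans _ _ (rho ^+ n.-1)).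
      by rewrite lerXn2r ?nnegrE ?rnorm_ge0 //; lra.
    by rewrite ler_weXn2l // leq_pred.
have p0 : 0 <= p by rewrite exprn_ge0 //; lra.
apply: (@le_trans _ _ (rho * (D * p) + D * p)).
  apply: lerD; last by rewrite ler_wpM2l.
  by apply: ler_pM => //; rewrite rnorm_ge0.
rewrite [leRHS](_ : _ = (2 * rho) * (D * p)); last by rewrite exprS /p; ring.
have : 0 <= D * p by rewrite mulr_ge0.
by nra.
Qed.

(** The quadratic remainders of the monomials sum up to a quadratic remainder of
    the series, since they are dominated by the terms at twice the radius. *)
Lemma psum_differentiable c x : entire_coeffs c -> differentiable (psum c) x.
Proof.
move=> ec; pose rho : R := rnorm x + 1.
have r1 : 1 <= rho by rewrite /rho; have := rnorm_ge0 x; lra.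
have xr : rnorm x <= rho by rewrite /rho; lra.
have [|M cM] := entire_coeffs_geometric (rho := 2 * rho) ec; first lra.
have dom n : rnorm (c n * (n%:R * x ^+ n.-1)) <= geometric M 2^-1 n.
  apply: le_trans (cM n); rewrite !rnormM rnormX rnorm_nat.
  rewrite ler_wpM2l ?rnorm_ge0 // exprMn; apply: ler_pM => //.
  - by rewrite exprn_ge0 ?rnorm_ge0.
  - by rewrite -natrX ler_nat ltnW // ltn_expl.
  - apply: (@le_trans _ _ (rho ^+ n.-1)).
      by rewrite lerXn2r ?nnegrE ?rnorm_ge0 //; lra.
    by rewrite ler_weXn2l // leq_pred.
have [cd _] := dominated_series dom (half_cvg M).
pose d := limn (series (fun n => c n * (n%:R * x ^+ n.-1))).
pose B := limn (series (geometric M 2^-1)).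
have B0 : 0 <= B.
  by apply: le_trans (dominated_series dom (half_cvg M)).2; apply: rnorm_ge0.
apply: (@quadratic_differentiable _ _ _ d (B%:C)%C); first by rewrite ler0c.
move=> y; rewrite rnormE (@lecR R _ 1) => yx.
have yr : rnorm y <= rho.
  by have := rnormD (y - x) x; rewrite subrK /rho; lra.
set D := rnorm (y - x) ^+ 2.
have dq n : rnorm (c n * (y ^+ n - x ^+ n - (y - x) * (n%:R * x ^+ n.-1)))
    <= (D *: geometric M 2^-1 : nat -> R) n.
  rewrite rnormM; apply: (@le_trans _ _ (rnorm (c n) * (D * (2 * rho) ^+ n))).
    by rewrite ler_wpM2l ?rnorm_ge0 // pow_remainder.
  by rewrite mulrCA; apply: ler_wpM2l; [exact: sqr_ge0 | exact: cM].
have [_] := dominated_series dq (is_cvg_seriesZ (half_cvg M)).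
rewrite lim_seriesZ; last exact: half_cvg.
rewrite rnormE -rmorphXn /= -rmorphM lecR.
have E := @lim_series_remainder C (fun n => y ^+ n) (fun n => x ^+ n)
  (fun n => n%:R * x ^+ n.-1) c (y - x) (entire_cvg ec) (entire_cvg ec) cd.
rewrite E => h; exact: h.
Qed.

End PowerSeries.

(** * The complex exponential *)

Section CauchyProduct.

Lemma triangular_sum (K : comPzRingType) (a b : nat -> K) N :
  \sum_(0 <= n < N) \sum_(0 <= i < n.+1) a i * b (n - i)%N =
  \sum_(0 <= i < N) a i * \sum_(0 <= j < N - i) b j.
Proof.
elim: N => [|N IH]; first by rewrite !big_nil.
rewrite big_nat_recr //= IH [in RHS]big_nat_recr //=.
rewrite [X in _ + X = _]big_nat_recr //= addrA -big_split /=.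
congr (_ + _).
  apply: eq_big_nat => i /andP[_ iN].
  by rewrite subSn 1?ltnW // big_nat_recr //= mulrDr.
by rewrite subSnn subnn big_nat1.
Qed.

(** The right-hand side is free of cancellation, so its modulus is controlled by
    the same expression in the moduli. *)
Lemma square_sub_triangle (K : comPzRingType) (a b : nat -> K) N :
  (\sum_(0 <= i < N) a i) * (\sum_(0 <= j < N) b j)
  - \sum_(0 <= n < N) \sum_(0 <= i < n.+1) a i * b (n - i)%N =
  \sum_(0 <= i < N) a i * \sum_(N - i <= j < N) b j.
Proof.
rewrite triangular_sum big_distrl /= -sumrB.
apply: eq_big_nat => i /andP[_ iN].
by rewrite -mulrBr (@big_cat_nat _ _ _ (N - i) 0 N) ?leq_subr //= addrAC subrr add0r.
Qed.

Lemma exp_coeff_sum (K : numFieldType) (z w : K) N :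
  \sum_(0 <= n < N) \sum_(0 <= i < n.+1)
     (z ^+ i / i`!%:R) * (w ^+ (n - i) / (n - i)`!%:R) =
  \sum_(0 <= n < N) (z + w) ^+ n / n`!%:R.
Proof.
apply: eq_bigr => n _; rewrite big_mkord addrC exprDn big_distrl /=.
apply: eq_bigr => i _; have ni : (i <= n)%N by rewrite -ltnS.
have f0 k : k`!%:R != 0 :> K by rewrite pnatr_eq0 -lt0n fact_gt0.
rewrite -mulr_natr -(bin_fact ni) !natrM.
have c0 : ('C(n, i))%:R != 0 :> K by rewrite pnatr_eq0 -lt0n bin_gt0.
by field; rewrite !f0 c0.
Qed.

End CauchyProduct.

Section ComplexExponential.
Variable R : realType.
Local Notation C := (Cplx R).
Local Open Scope classical_set_scope.
Implicit Types z w : C.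

Lemma cvg_rnorm_le0 (u : nat -> C) (s : C) (v : nat -> R) :
  u @ \oo --> s -> v @ \oo --> 0 -> (forall n, rnorm (u n) <= v n) -> s = 0.
Proof.
move=> us v0 uv; apply/eqP; rewrite -rnorm_eq0.
rewrite eq_le rnorm_ge0 andbT leNgt; apply/negP => s0.
have e2 : 0 < rnorm s / 2 by lra.
have e2C : 0 < ((rnorm s / 2)%:C)%C :> C by rewrite ltcR.
near \oo => n.
have : `|0 - v n| < rnorm s / 2 by near: n; apply: cvgr_dist_lt.
have : `|s - u n| < ((rnorm s / 2)%:C)%C.
  near: n; exact: pseudometric_normed_Zmodule.cvgr_dist_lt.
rewrite rnormE ltcR sub0r normrN.
have := ler_norm (v n); have := uv n.
have := rnormD (s - u n) (u n); rewrite subrK; lra.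
Unshelve. all: by end_near. Qed.

Definition cexp z : C := psum (fun n => (n`!%:R)^-1) z.

Lemma entire_inv_fact : entire_coeffs (fun n => (n`!%:R)^-1 : C).
Proof.
move=> rho r0; exists (expR rho) => n; rewrite rnormV rnorm_nat mulrC.
case: n => [|n]; first by rewrite expr0 fact0 divr1 -[leLHS]expR0 ler_expR ltW.
by have := expR_ge1Dxn n (ltW r0); lra.
Qed.

Lemma cexp_cvg z :
  series (fun n => z ^+ n / n`!%:R) @ \oo --> cexp z.
Proof.
have -> : (fun n => z ^+ n / n`!%:R) = (fun n => (n`!%:R)^-1 * z ^+ n).
  by apply/funext => n; rewrite mulrC.
exact: (entire_cvg (x := z) entire_inv_fact).
Qed.

(** The error of the Cauchy product of the partial sums at [z] and [w] is a sum
    of monomials with nonnegative coefficients, so it is bounded by the same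
    error at [|z|] and [|w|], where the real exponential makes it vanish in the
    limit. *)
Lemma cexpD z w : cexp (z + w) = cexp z * cexp w.
Proof.
pose t z n : C := z ^+ n / n`!%:R.
pose u N := series (t z) N * series (t w) N - series (t (z + w)) N.
pose r := rnorm z; pose s := rnorm w.
pose v N := series (exp_coeff r) N * series (exp_coeff s) N
            - series (exp_coeff (r + s)) N.
have tn x n : rnorm (t x n) = exp_coeff (rnorm x) n.
  by rewrite /t rnormM rnormX rnormV rnorm_nat.
have uv N : rnorm (u N) <= v N.
  rewrite /u /v !seriesEnat /= /t -!exp_coeff_sum !square_sub_triangle.
  apply: (le_trans (rnorm_sum _ _)); apply: ler_sum => i _.
  rewrite rnormM -/(t z i) tn ler_wpM2l ?exp_coeff_ge0 ?rnorm_ge0 //.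
  apply: (le_trans (rnorm_sum _ _)); apply: ler_sum => j _.
  by rewrite -/(t w j) tn.
have v0 : v @ \oo --> 0.
  rewrite -(subrr (expR (r + s))) {1}expRD.
  by apply: cvgB; [apply: cvgM|]; exact: is_cvg_series_exp_coeff.
have us : u @ \oo --> cexp z * cexp w - cexp (z + w).
  by apply: cvgB; [apply: cvgM|]; exact: cexp_cvg.
by apply/esym/eqP; rewrite -subr_eq0; apply/eqP/(cvg_rnorm_le0 us v0 uv).
Qed.

Lemma cexp_differentiable z : differentiable cexp z.
Proof. exact: psum_differentiable entire_inv_fact. Qed.

Lemma cexp0 : cexp 0 = 1.
Proof. by rewrite /cexp psum_at0 ?fact0 ?invr1 //; exact: entire_inv_fact. Qed.

Lemma cexp_neq0 z : cexp z != 0.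
Proof.
apply/eqP => z0; have := cexpD z (- z); rewrite subrr cexp0 z0 mul0r.
by move/eqP; rewrite oner_eq0.
Qed.

Lemma cexpN z : cexp (- z) = (cexp z)^-1.
Proof.
by apply: (mulfI (cexp_neq0 z)); rewrite -cexpD subrr cexp0 mulfV ?cexp_neq0.
Qed.

Lemma cexp_real (x : R) : cexp (x%:C)%C = ((expR x)%:C)%C.
Proof.
rewrite -(cvg_lim (@norm_hausdorff _ _) (@cexp_cvg _)).
apply: cvg_lim; first exact: norm_hausdorff.
have tE n : (x%:C)%C ^+ n / n`!%:R = ((exp_coeff x n)%:C)%C :> C.
  by rewrite /exp_coeff /= rmorphM rmorphXn fmorphV rmorph_nat.
apply: cvg_ReIm.
  rewrite (_ : _ \o _ = series (exp_coeff x)); last first.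
    apply/funext => n /=; rewrite Re_sum; apply: eq_bigr => i _.
    by rewrite tE.
  exact: is_cvg_series_exp_coeff.
rewrite (_ : _ \o _ = cst 0); first exact: cvg_cst.
apply/funext => n /=; rewrite Im_sum big1 // => i _.
by rewrite tE.
Qed.

(** Term by term, the exponential series on the imaginary axis is made of the
    cosine and sine series; hence Euler's formula. *)
Lemma exp_imag_coeff (y : R) n :
  (0 +i* y)%C ^+ n / n`!%:R = (cos_coeff y n +i* sin_coeff y n)%C :> C.
Proof.
have E k : (0 +i* y)%C ^+ k.*2 = (((-1) ^+ k * y ^+ k.*2)%:C)%C :> C.
  rewrite -mul2n exprM (_ : (0 +i* y)%C ^+ 2 = ((- y ^+ 2)%:C)%C); last first.
    by apply/eqP; rewrite eq_complex /=; apply/andP; split; apply/eqP; ring.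
  by rewrite -rmorphXn [in LHS]exprNn exprM.
have fV : (n`!%:R)^-1 = (((n`!%:R)^-1)%:C)%C :> C.
  by rewrite fmorphV rmorph_nat.
rewrite fV /cos_coeff /sin_coeff /=.
rewrite -{1}(odd_double_half n) exprD E.
case: (boolP (odd n)) => on /=; apply/eqP; rewrite eq_complex /=.
  have nE : n = n./2.*2.+1 by rewrite -{1}(odd_double_half n) on.
  have -> : n.-1./2 = n./2 by rewrite {1}nE /= doubleK.
  have -> : y ^+ n = y * y ^+ n./2.*2 by rewrite -exprS -nE.
  by apply/andP; split; apply/eqP; rewrite /=; ring.
have -> : y ^+ n./2.*2 = y ^+ n.
  by rewrite -{2}(odd_double_half n) (negPf on).
by apply/andP; split; apply/eqP; rewrite -?exprnP; ring.
Qed.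

Lemma cexp_imag (y : R) : cexp (0 +i* y)%C = (cos y +i* sin y)%C.
Proof.
rewrite -(cvg_lim (@norm_hausdorff _ _) (@cexp_cvg _)).
apply: cvg_lim; first exact: norm_hausdorff.
apply: cvg_ReIm.
  rewrite (_ : _ \o _ = series (cos_coeff y)); last first.
    apply/funext => n /=; rewrite Re_sum; apply: eq_bigr => i _.
    by rewrite exp_imag_coeff.
  by rewrite unlock; exact: is_cvg_series_cos_coeff.
rewrite (_ : _ \o _ = series (sin_coeff y)); last first.
  apply/funext => n /=; rewrite Im_sum; apply: eq_bigr => i _.
  by rewrite exp_imag_coeff.
by rewrite unlock; exact: is_cvg_series_sin_coeff.
Qed.

Lemma rnorm_cexp z : rnorm (cexp z) = expR (complex.Re z).
Proof.
have -> : z = (complex.Re z)%:C%C + (0 +i* complex.Im z)%C :> C.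
  by case: z => a b; apply/eqP; rewrite eq_complex /= addr0 add0r !eqxx.
rewrite cexpD rnormM cexp_real cexp_imag rnorm_real ger0_norm ?expR_ge0 //.
by rewrite {1}/rnorm /= cos2Dsin2 sqrtr1 mulr1 addr0.
Qed.

Lemma cexp_2pi (k : int) : cexp (0 +i* (k%:~R * (pi *+ 2)))%C = 1.
Proof.
have nat_case n : cexp (0 +i* (n%:R * (pi *+ 2)))%C = 1.
  elim: n => [|n IH]; first by rewrite mul0r; exact: cexp0.
  have -> : (0 +i* (n.+1%:R * (pi *+ 2)))%C =
      (0 +i* (n%:R * (pi *+ 2)))%C + (0 +i* (pi *+ 2))%C :> C.
    apply/eqP; rewrite eq_complex /= addr0 eqxx /=; apply/eqP.
    by rewrite -natr1; ring.
  by rewrite cexpD IH mul1r cexp_imag cos2pi sin2pi.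
have [|n|n] := intP k; [exact: (nat_case 0%N) | exact: nat_case |].
have -> : (0 +i* ((- n.+1%:Z)%:~R * (pi *+ 2)))%C =
    - (0 +i* (n.+1%:R * (pi *+ 2)))%C :> C.
  by apply/eqP; rewrite eq_complex /= oppr0 eqxx rmorphN /= mulNr /=.
by rewrite cexpN nat_case invr1.
Qed.

(** The modulus forces the real part to vanish.  Once the imaginary
    part is reduced modulo the period to [0 <= r < 2 pi], the identity
    [cos r = 1 - 2 * sin (r / 2) ^+ 2] forces [r = 0]. *)
Lemma cexp_eq1 z : cexp z = 1 -> exists k : int, z = (0 +i* (k%:~R * (pi *+ 2)))%C.
Proof.
move=> z1.
have x0 : complex.Re z = 0.
  by apply: expR_inj; rewrite expR0 -rnorm_cexp z1 rnorm1.
have zE : z = (0 +i* complex.Im z)%C by case: z x0 {z1} => a b /= ->.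
have p0 : 0 < pi :> R by exact: pi_gt0.
pose T : R := pi *+ 2.
have T0 : 0 < T by rewrite /T; lra.
pose k := Num.floor (complex.Im z / T); exists k.
pose r := complex.Im z - k%:~R * T.
have r0 : 0 <= r by rewrite /r subr_ge0 -ler_pdivlMr // Num.Theory.floor_le.
have rT : r < T.
  have := floorD1_gt (complex.Im z / T); rewrite ltr_pdivrMr // -/k.
  by rewrite intrD /r; lra.
have r1 : cexp (0 +i* r)%C = 1.
  have -> : (0 +i* r)%C = z - (0 +i* (k%:~R * T))%C :> C.
    by rewrite [in RHS]zE; apply/eqP; rewrite eq_complex /= subr0 !eqxx.
  by rewrite cexpD cexpN z1 cexp_2pi invr1 mulr1.
suff : r = 0.
  by move/eqP; rewrite subr_eq0 => /eqP rE; rewrite zE rE.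
apply/eqP; move: r0; rewrite le_eqVlt => /orP[/eqP <-//|r0].
have s0 : 0 < sin (r / 2) by apply: sin_gt0_pi; move: rT; rewrite /T; lra.
move: r1; rewrite cexp_imag => -[c1 _].
have : cos (r / 2 *+ 2) = 1 by rewrite (_ : r / 2 *+ 2 = r) //; lra.
by rewrite cos_mulr2n cos2sin2; nra.
Qed.

(** The quotient [(exp z - 1) / z] is again given by a power series, which makes
    the zero of [exp z - 1] at the origin visibly simple. *)
Lemma cexpB1 z : cexp z - 1 = z * psum (fun n => (n.+1`!%:R)^-1) z.
Proof.
by rewrite /cexp psum_recl ?fact0 ?invr1 1?addrC ?addKr //; exact: entire_inv_fact.
Qed.

End ComplexExponential.

(** * Entire functions *)

Section Entire.
Variable K : numFieldType.
Implicit Types f h : K -> K.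

Definition entire f : Prop := forall x : K, differentiable f x.

Lemma entire_affine f (a b : K) : entire f -> entire (fun x => f (a * x + b)).
Proof.
by move=> df x; apply: (@differentiable_comp _ _ _ _ (fun x => a * x + b) f).
Qed.

Lemma entireM f h : entire f -> entire h -> entire (fun x => f x * h x).
Proof. by move=> df dh x; apply: differentiableM. Qed.

Lemma entire_comp f h : entire f -> entire h -> entire (fun x => f (h x)).
Proof. by move=> df dh x; apply: (@differentiable_comp _ _ _ _ h f). Qed.

Lemma entireZ f a : entire f -> entire (fun x => a * f x).
Proof. by move=> df x; apply: (@differentiableZ _ _ _ f). Qed.

Local Open Scope classical_set_scope.

Lemma lim_seriesB_fun (c d : nat -> K) (x : K) :
  cvgn (series (fun n => c n * x ^+ n)) ->
  cvgn (series (fun n => d n * x ^+ n)) ->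
  limn (series (fun n => (c n - d n) * x ^+ n)) =
  limn (series (fun n => c n * x ^+ n)) - limn (series (fun n => d n * x ^+ n)).
Proof.
move=> cc cd; rewrite -lim_seriesB //; congr (limn (series _)).
by apply/funext => n; rewrite mulrBl.
Qed.

End Entire.

(** * Euler's q-product *)

Section EulerProduct.
Variable R : realType.
Local Notation C := (Cplx R).
Local Open Scope classical_set_scope.
Variable q : C.
Hypothesis q1 : rnorm q < 1.

Fixpoint euler_coeff n : C :=
  if n is n'.+1 then - (q ^+ n' / (1 - q ^+ n'.+1)) * euler_coeff n' else 1.

(** The product [\prod_(n >= 0) (1 - q ^+ n * x)], given by the power series
    which its functional equation dictates. *)
Definition euler_prod (x : C) : C := psum euler_coeff x.

Lemma bounded_of_eventually_decreasing (u : nat -> R) N :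
  (forall n, 0 <= u n) -> (forall n, (N <= n)%N -> u n.+1 <= u n) ->
  exists M, forall n, u n <= M.
Proof.
move=> u0 uN; exists (\sum_(i < N.+1) u i) => n.
have [nN|Nn] := leqP n N.
  rewrite -ltnS in nN; rewrite (bigD1 (Ordinal nN)) //= lerDl.
  by apply: sumr_ge0.
have uNn : u n <= u N.
  rewrite -(subnK (ltnW Nn)); elim: (n - N)%N => [//|k IH].
  by apply: le_trans IH; rewrite addSn uN // leq_addl.
apply: (le_trans uNn); rewrite (bigD1 ord_max) //= lerDl.
by apply: sumr_ge0.
Qed.

Lemma pow_small (r e : R) : 0 <= r < 1 -> 0 < e ->
  exists N, forall n, (N <= n)%N -> r ^+ n < e.
Proof.
move=> /andP[r0 r1] e0.
have := @cvg_geometric R 1 r; rewrite ger0_norm // => /(_ r1) cr.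
have [N _ hN] := (@pseudometric_normed_Zmodule.cvgr_dist_lt _ _ _ _ _ _ _ cr _ e0).
exists N => n Nn; have := hN n Nn; rewrite /= mul1r sub0r normrN ger0_norm //.
exact: exprn_ge0.
Qed.

Lemma rnorm_1B (n : nat) : 1 - rnorm q <= rnorm (1 - q ^+ n.+1).
Proof.
have := rnormD (1 - q ^+ n.+1) (q ^+ n.+1); rewrite subrK rnorm1 rnormX.
have : rnorm q ^+ n.+1 <= rnorm q.
  by rewrite exprS ler_piMr ?rnorm_ge0 // exprn_ile1 ?rnorm_ge0 // ltW.
lra.
Qed.

Lemma qpow_neq1 (n : nat) : 1 - q ^+ n.+1 != 0.
Proof. by rewrite -rnorm_eq0 gt_eqF //; have := rnorm_1B n; move: q1; lra. Qed.

(** The ratio of consecutive terms at radius [rho] is at most [k * |q| ^+ n],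
    which is eventually less than [1]. *)
Lemma euler_coeff_entire : entire_coeffs euler_coeff.
Proof.
move=> rho rho0; have r0 := rnorm_ge0 q.
pose k := rho / (1 - rnorm q).
have k0 : 0 < k by apply: divr_gt0 => //; move: q1; lra.
(* Beyond [N] the terms decrease. *)
have [||N hN] := @pow_small (rnorm q) k^-1.
- by rewrite rnorm_ge0.
- by rewrite invr_gt0.
apply: (@bounded_of_eventually_decreasing _ N) => n.
  by rewrite mulr_ge0 ?rnorm_ge0 // exprn_ge0 // ltW.
move=> Nn; have a0 : 0 <= rnorm (euler_coeff n) * rho ^+ n.
  by rewrite mulr_ge0 ?rnorm_ge0 // exprn_ge0 // ltW.
rewrite /= rnormM rnormN rnormM rnormV rnormX [rho ^+ n.+1]exprS.
rewrite [leLHS](_ : _ = (rnorm q ^+ n * (rho / rnorm (1 - q ^+ n.+1))) *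
   (rnorm (euler_coeff n) * rho ^+ n)); last by ring.
rewrite ler_piMl //; apply: (@le_trans _ _ (rnorm q ^+ n * k)).
  rewrite ler_wpM2l ?exprn_ge0 // ler_pM2l // lef_pV2 ?rnorm_1B // posrE.
    by have := rnorm_1B n; move: q1; lra.
  by move: q1; lra.
by rewrite -ler_pdivlMr // mul1r ltW // hN.
Qed.

Lemma euler_prod_entire : entire euler_prod.
Proof. by move=> x; apply: psum_differentiable; exact: euler_coeff_entire. Qed.

Lemma euler_prod0 : euler_prod 0 = 1.
Proof. by rewrite /euler_prod psum_at0 //; exact: euler_coeff_entire. Qed.

(** Comparing coefficients, this is the recurrence
    [c n.+1 = q ^+ n.+1 * c n.+1 - q ^+ n * c n] defining [euler_coeff]. *)
Lemma euler_prodE x : euler_prod x = (1 - x) * euler_prod (q * x).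
Proof.
pose c := euler_coeff; pose d n : C := c n * q ^+ n.
have ec : entire_coeffs c by exact: euler_coeff_entire.
have ed : entire_coeffs d.
  move=> rho rho0; have [M cM] := ec _ rho0; exists M => n.
  apply: le_trans (cM n); rewrite ler_wpM2r ?exprn_ge0 ?(ltW rho0) //.
  rewrite rnormM rnormX ler_piMr ?rnorm_ge0 //.
  by rewrite exprn_ile1 ?rnorm_ge0 // ltW.
have cd n : c n.+1 = d n.+1 - d n.
  rewrite /d /c [euler_coeff n.+1]/=; have := qpow_neq1 n.
  by rewrite !exprS => h; field.
have -> : euler_prod (q * x) = psum d x.
  rewrite /euler_prod /psum; congr (limn (series _)).
  by apply/funext => n; rewrite exprMn mulrA.
have E : psum (c \o S) x = psum (d \o S) x - psum d x.
  have := @lim_seriesB_fun C (d \o S) d x.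
  move=> /(_ (entire_cvg (entire_shift ed)) (entire_cvg ed)) <-.
  rewrite /psum; congr (limn (series _)); apply/funext => n.
  by rewrite -[(c \o S) n]/(c n.+1) cd.
rewrite /euler_prod -/c psum_recl // E.
rewrite mulrBl mul1r [X in _ = X - _]psum_recl // /d expr0 mulr1 /=.
by rewrite mulrBr addrA.
Qed.

(** Iterating the functional equation splits off the factors [1 - q ^+ k * x];
    what remains is the value at [q ^+ N * x], which is close to the value [1] at
    the origin. *)
Lemma euler_prod_zero x : euler_prod x = 0 -> exists k : nat, q ^+ k * x = 1.
Proof.
have [N] : exists N, euler_prod (q ^+ N * x) != 0.
  have /differentiable_continuous := @euler_prod_entire 0.
  move=> /pseudometric_normed_Zmodule.cvgr_dist_lt /(_ 1 ltr01).
  rewrite euler_prod0 => /nbhs_ballP[e /= /cplx_gt0[r r0 ->]] h.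
  have [||N hN] := @pow_small (rnorm q) (r / (rnorm x + 1)).
  - by rewrite rnorm_ge0.
  - by rewrite divr_gt0 // ltr_wpDl ?rnorm_ge0.
  exists N; apply/negP => /eqP F0.
  have /h : ball 0 (r%:C)%C (q ^+ N * x).
    rewrite -ball_normE /= sub0r normrN rnormE ltcR rnormM rnormX.
    have := hN N (leqnn N); rewrite ltr_pdivlMr ?ltr_wpDl ?rnorm_ge0 //.
    apply: le_lt_trans; rewrite ler_wpM2l ?exprn_ge0 ?rnorm_ge0 //; lra.
  by rewrite /= F0 subr0 normr1 ltxx.
elim: N x => [|N IH] x; first by rewrite mul1r => /eqP.
move=> hN /eqP; rewrite euler_prodE mulf_eq0 => /orP[|/eqP F0].
  by rewrite subr_eq0 => /eqP <-; exists 0%N; rewrite mulr1.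
have [|k kx] := IH (q * x) _ F0; first by rewrite mulrA -exprSr.
by exists k.+1; rewrite exprSr -mulrA.
Qed.

Lemma euler_prod_q : euler_prod q != 0.
Proof.
apply/eqP => /euler_prod_zero[k]; rewrite -exprSr => /eqP.
by rewrite eq_sym -subr_eq0 (negPf (qpow_neq1 k)).
Qed.

End EulerProduct.

(** * Sigma functions *)

Opaque cexp euler_prod psum.

Section Theta.
Variables (K : fieldType) (F e : K -> K) (q : K).
Hypothesis FE : forall x, F x = (1 - x) * F (q * x).
Hypothesis eD : forall u v, e (u + v) = e u * e v.
Hypothesis e0 : forall u, e u != 0.

Let eN u : e (- u) = (e u)^-1.
Proof.
have e00 : e 0 = 1 by apply: (mulfI (e0 0)); rewrite -eD addr0 mulr1.
by apply: (mulfI (e0 u)); rewrite -eD subrr e00 mulfV.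
Qed.

Lemma theta_period w u : e w = 1 ->
  F (e (u + w)) * F (q * e (- (u + w))) = F (e u) * F (q * e (- u)).
Proof. by move=> ew; rewrite !eN eD ew mulr1. Qed.

(** The shift replaces the factor [1 - e u] of [F (e u) * F (q / e u)] by
    [1 - (e u)^-1], which amounts to a multiplication by [- (e u)^-1]. *)
Lemma theta_quasi_period w u : e w = q ->
  F (e (u + w)) * F (q * e (- (u + w))) = - e (- u) * (F (e u) * F (q * e (- u))).
Proof.
move=> ew; have q0 : q != 0 by rewrite -ew.
have -> : q * e (- (u + w)) = e (- u).
  by rewrite !eN eD ew; field; rewrite q0 e0.
by rewrite eD ew [e u * q]mulrC (FE (e u)) (FE (e (- u))) eN; field.
Qed.

End Theta.

Section Sigma.
Variables (R : realType) (L : zmodClosed (Cplx R)).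
Local Notation C := (Cplx R).
Local Notation Im := (@complex.Im R).
Implicit Types (u w : C) (S kappa : C -> C).

Definition quasi_periodic S kappa w : Prop :=
  exists2 A : C, A != 0 & forall u, S (u + w) = A * cexp (kappa w * u) * S u.

(** The properties of the Weierstrass sigma function on which the proof rests;
    [kappa] plays the role of the quasi-period map [eta]. *)
Definition sigma_function S kappa : Prop :=
  [/\ {morph kappa : x y / x + y},
      forall w, w \in L -> quasi_periodic S kappa w,
      forall u, S u = 0 -> u \in L
    & exists2 G, entire G /\ G 0 != 0 & forall u, S u = u * G u].

(** Multipliers form a cocycle, so it suffices to know them on a basis of the
    lattice. *)
Lemma quasi_periodicD S kappa w w' : {morph kappa : x y / x + y} ->
  quasi_periodic S kappa w -> quasi_periodic S kappa w' ->
  quasi_periodic S kappa (w + w').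
Proof.
move=> kD [A A0 Aw] [B B0 Bw]; exists (B * cexp (kappa w' * w) * A).
  by rewrite !mulf_neq0 ?cexp_neq0.
move=> u; rewrite addrA Bw Aw kD mulrDl mulrDr !cexpD.
move: (cexp (kappa w' * u)) (cexp (kappa w' * w)) (cexp (kappa w * u)) (S u).
by move=> a b c d; ring.
Qed.

Lemma quasi_periodicN S kappa w : {morph kappa : x y / x + y} ->
  quasi_periodic S kappa w -> quasi_periodic S kappa (- w).
Proof.
move=> kD [A A0 Aw].
have k0 : kappa 0 = 0 by apply: (addrI (kappa 0)); rewrite -kD !addr0.
have kN : kappa (- w) = - kappa w.
  by apply: (addrI (kappa w)); rewrite -kD !subrr.
exists (A^-1 * cexp (kappa w * w)).
  by rewrite mulf_neq0 ?cexp_neq0 ?invr_eq0.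
move=> u; have := Aw (u - w); rewrite subrK => ->.
rewrite kN mulNr cexpN mulrBr cexpD cexpN.
move: (cexp_neq0 (kappa w * w)) (cexp_neq0 (kappa w * u)).
move: (cexp _) (cexp _) (S _) => a b c a0 b0.
by field; rewrite A0 a0 b0.
Qed.

Lemma quasi_periodic_int S kappa w (n : int) : {morph kappa : x y / x + y} ->
  quasi_periodic S kappa w -> quasi_periodic S kappa (w *~ n).
Proof.
move=> kD qw.
have k0 : kappa 0 = 0 by apply: (addrI (kappa 0)); rewrite -kD !addr0.
have nat_case k : quasi_periodic S kappa (w *+ k).
  elim: k => [|k IH]; last by rewrite mulrS; apply: quasi_periodicD.
  exists 1; first exact: oner_neq0.
  by move=> u; rewrite mulr0n k0 mul0r addr0 cexp0 !mul1r.
case: n => n; first exact: nat_case.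
exact: (quasi_periodicN kD (nat_case n.+1)).
Qed.

(** Near each lattice point a sigma function is the local coordinate times a
    unit: this holds at the origin, and quasi-periodicity transports it. *)
Lemma sigma_factor S kappa w : sigma_function S kappa -> w \in L ->
  exists2 U, entire U /\ U w != 0 & forall u, S u = (u - w) * U u.
Proof.
move=> [_ qp _ [G [eG G0] SG]] /qp[A A0 Aw].
exists (fun u => A * (cexp (kappa w * u + - (kappa w * w)) * G (1 * u + - w))).
  split.
    apply: entireZ; apply: entireM; last exact: entire_affine.
    by apply: entire_affine => x; exact: cexp_differentiable.
  rewrite mul1r !subrr; apply: mulf_neq0 => //; apply: mulf_neq0 => //.
  exact: cexp_neq0.
move=> u; rewrite -[in LHS](subrK w u) Aw SG mulrBr mul1r.
by move: (cexp _) (G _) => a b; ring.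
Qed.

Lemma sigma_entire S kappa : sigma_function S kappa -> entire S.
Proof.
move=> [_ _ _ [G [eG _] SG]] x.
have -> : S = fun u => id u * G u by apply/funext => u; rewrite SG.
exact: differentiableM.
Qed.

Lemma lattice_oriented_basis : is_lattice L ->
  exists w1 w2 : C, [/\ w1 != 0, 0 < Im (w2 / w1)
    & forall u, u \in L <-> exists m n : int, u = w1 *~ m + w2 *~ n].
Proof.
move=> [w1 [w2 [ind LE]]].
have w10 : w1 != 0.
  apply/eqP => w10; have [|/eqP] := ind 1 0; last by rewrite oner_eq0.
  by rewrite w10 mulr0 mul0r addr0.
have Im0 : Im (w2 / w1) != 0.
  apply/eqP => I0; have [|_ /eqP] := ind (- complex.Re (w2 / w1)) 1; last first.
    by rewrite oner_eq0.
  have e : ((- complex.Re (w2 / w1))%:C)%C = - (w2 / w1).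
    case: (w2 / w1) I0 => a b /= ->.
    by apply/eqP; rewrite eq_complex /= oppr0 !eqxx.
  by rewrite e mulNr divfK // mul1r addNr.
have [I_pos|I_neg] := ltP 0 (Im (w2 / w1)); first by exists w1, w2.
exists w1, (- w2); split => //.
  by rewrite mulNr ImN oppr_gt0 lt_neqAle Im0.
move=> u; rewrite LE; split=> -[m [n ->]]; exists m, (- n).
  by rewrite mulrNz mulNrz opprK.
by rewrite mulrNz mulNrz.
Qed.

(** With [e u = exp (2 i pi u / w1)] and [q = e w2], Euler's product [F] gives
    [S u = F (e u) * F (q * e (- u))].  It has period [w1], it is multiplied by
    [- e (- u)] under [w2], and it vanishes where [e u] is a power of [q], that is,
    on the lattice. *)
Theorem sigma_function_exists : is_lattice L ->
  exists S kappa, sigma_function S kappa.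
Proof.
move=> /lattice_oriented_basis[w1 [w2 [w10 I0 LE]]].
pose alpha : C := (0 +i* (pi *+ 2))%C / w1.
pose e u := cexp (alpha * u); pose q := e w2.
have alpha0 : alpha != 0.
  rewrite mulf_neq0 ?invr_eq0 // eq_complex /= eqxx /=.
  by rewrite gt_eqF // mulrn_wgt0 // pi_gt0.
have eD u v : e (u + v) = e u * e v by rewrite /e mulrDr cexpD.
have eN u : e (- u) = (e u)^-1 by rewrite /e mulrN cexpN.
have e0 u : e u != 0 by exact: cexp_neq0.
have e1 : e w1 = 1.
  have := cexp_2pi R 1.
  rewrite mulr1z mul1r /e /alpha divfK //.
have qlt1 : rnorm q < 1.
  rewrite /q /e rnorm_cexp expR_lt1 /alpha mulrAC -mulrA.
  have := I0; have := pi_gt0 R; case: (w2 / w1) => a b /= p0 b0.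
  by rewrite mul0r sub0r oppr_lt0 mulr_gt0 // mulrn_wgt0.
pose F := euler_prod q.
have FE x : F x = (1 - x) * F (q * x) by exact: euler_prodE.
pose S u := F (e u) * F (q * e (- u)).
pose kappa u : C := - alpha * ((Im (u / w1) / Im (w2 / w1))%:C)%C.
have kD : {morph kappa : x y / x + y}.
  by move=> x y; rewrite /kappa mulrDl ImD mulrDl rmorphD mulrDr.
have k1 : kappa w1 = 0 by rewrite /kappa mulfV //= mul0r mulr0.
have k2 : kappa w2 = - alpha by rewrite /kappa mulfV ?gt_eqF // mulr1.
have q1 : quasi_periodic S kappa w1.
  exists 1; first exact: oner_neq0.
  by move=> u; rewrite k1 mul0r cexp0 !mul1r; exact: (theta_period F q eD e0 u e1).
have q2 : quasi_periodic S kappa w2.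
  exists (-1); first by rewrite oppr_eq0 oner_neq0.
  move=> u; rewrite k2 (_ : - alpha * u = alpha * - u); last first.
    by rewrite mulrN mulNr.
  rewrite mulN1r; exact: (theta_quasi_period FE eD e0 u (erefl q)).
exists S, kappa; split; first exact: kD.
- move=> w /LE[m [n ->]].
  exact: (quasi_periodicD kD (quasi_periodic_int m kD q1)
                             (quasi_periodic_int n kD q2)).
- have w2L k : w2 *+ k \in L by apply/LE; exists 0, k; rewrite mulr0z add0r.
  have eL v : e v = 1 -> v \in L.
    move=> /cexp_eq1[k vk]; apply/LE; exists k, 0; rewrite mulr0z addr0.
    apply: (mulfI alpha0); rewrite vk -[w1 *~ k]mulrzr /alpha mulrA divfK //.
    apply/eqP; rewrite -(rmorph_int (real_complex R)) eq_complex /=.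
    by apply/andP; split; apply/eqP; ring.
  have qE k : q ^+ k = e (w2 *+ k).
    elim: k => [|k IH]; first by rewrite mulr0n /e mulr0 cexp0.
    by rewrite exprS IH mulrS eD.
  move=> u /eqP; rewrite mulf_eq0 => /orP[] /eqP /(euler_prod_zero qlt1)[k].
    by rewrite qE -eD => /eL uL; rewrite -(addKr (w2 *+ k) u) rpredD ?rpredN.
  rewrite mulrA -exprSr qE -eD => /eL uL.
  by rewrite -rpredN -(addKr (w2 *+ k.+1) (- u)) rpredD ?rpredN.
pose H z := psum (fun n => (n.+1`!%:R)^-1 : C) z.
have eH' := entire_shift (@entire_inv_fact R).
have eH : entire H by move=> z; apply: psum_differentiable.
have eF : entire F by exact: euler_prod_entire.
have ecexp : entire (@cexp R) by move=> z; exact: cexp_differentiable.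
have Fq0 : F q != 0 by exact: euler_prod_q.
have H0 : H 0 = 1.
  by rewrite /H psum_at0; [rewrite -[_`!]/1%N invr1 | exact: eH'].
have eFq a : entire (fun u => F (q * cexp (a * u + 0))).
  exact: (entire_comp eF (entireZ q (entire_affine a 0 ecexp))).
exists (fun u => - alpha * (H (alpha * u + 0) *
   (F (q * cexp (alpha * u + 0)) * F (q * cexp (- alpha * u + 0))))).
  split.
    exact: (entireZ (- alpha) (entireM (entire_affine alpha 0 eH)
             (entireM (eFq alpha) (eFq (- alpha))))).
  have a0 a : a * 0 + 0 = 0 :> C by rewrite mulr0 addr0.
  rewrite !a0 cexp0 H0 mul1r mulr1.
  apply: mulf_neq0; first by rewrite oppr_eq0.
  exact: (mulf_neq0 Fq0 Fq0).
move=> u; rewrite !addr0 [- alpha * u]mulNr -[- (alpha * u)]mulrN.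
have h : e u = 1 + alpha * u * H (alpha * u).
  by have := cexpB1 (alpha * u) => /(canRL (subrK _)); rewrite addrC.
rewrite /S [F (e u)]FE h.
rewrite -/(e u) -/(e (- u)) h.
by move: (H _) (F _) (F _) => a b c; ring.
Qed.

End Sigma.

(** * Properties that hold on a dense open set *)

Section Generic.
Local Open Scope classical_set_scope.
Variable T : topologicalType.
Implicit Types (a : T) (P Q : set T).

(** Equality of germs is equality on an open set that is dense near the point;
    such sets are treated here as the members of a filter. *)
Definition generic a P : Prop := \forall v \near a, closure (P°) v.

(** Two open sets that are dense near [a] meet in an open set that is dense
    near [a]. *)
Lemma generic_filter a : Filter (generic a).
Proof.
split.
- by apply: nearW => v; rewrite interiorT closureT.
- move=> P Q; rewrite /generic => hP hQ.
  have hQ' := near_join hQ.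
  apply: filterS2 hP hQ' => v Pv Qv B Bv.
  have {}Qv : nbhs v [set u | closure Q° u] by [].
  have [u [Pu [/= Qu Bu]]] :=
    Pv _ (filterI (nbhs_interior Qv) (nbhs_interior Bv)).
  have [t [Qt [Pt Bt]]] := interior_subset Qu _
    (filterI (open_nbhs_nbhs (conj (@open_interior _ P) Pu))
             (open_nbhs_nbhs (conj (@open_interior _ B) Bu))).
  by exists t; split; [rewrite interiorI | exact: interior_subset].
- move=> P Q PQ; rewrite /generic; apply: filterS => v.
  exact/closureS/interiorS.
Qed.
#[global] Existing Instance generic_filter.

Lemma generic_near a P : (\forall v \near a, P v) -> generic a P.
Proof.
move=> /near_join; apply: filterS => v Pv; apply: subset_closure.
exact: Pv.
Qed.

Lemma generic_nonzero (K : numFieldType) a (f : T -> K) :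
  generic a [set v | f v != 0] ->
  \forall v \near a, closure [set v | f v != 0] v.
Proof.
have h := closureS (@interior_subset _ [set v | f v != 0]).
exact: filterS h.
Qed.

End Generic.

Section NormedField.
Local Open Scope classical_set_scope.
Variables (K : numFieldType) (W : normedModType K).

Lemma near_neq0 (f : W -> K) x : differentiable f x -> f x != 0 ->
  \forall y \near x, f y != 0.
Proof.
move=> /differentiable_continuous cf f0.
have n0 : 0 < `|f x| by rewrite normr_gt0.
move: cf => /pseudometric_normed_Zmodule.cvgr_dist_lt /(_ _ n0).
apply: filterS => y; apply: contraTneq => ->.
by rewrite subr0 ltxx.
Qed.

Lemma differentiable_prod (I : Type) (s : seq I) (f : I -> W -> K) x :
  (forall i, differentiable (f i) x) ->
  differentiable (fun v => \prod_(i <- s) f i v) x.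
Proof.
move=> df; elim: s => [|i s IH].
  rewrite (_ : (fun v => _) = cst 1) //.
  by apply/funext => v; rewrite big_nil.
rewrite (_ : (fun v => _) = (fun v => f i v * \prod_(j <- s) f j v)).
  exact: differentiableM.
by apply/funext => v; rewrite big_cons.
Qed.

Lemma entire_comp_sub (U : K -> K) (f : W -> K) c x : entire U ->
  differentiable f x -> differentiable (fun v => U (f v - c)) x.
Proof.
move=> eU df; apply: (@differentiable_comp _ _ _ _ (fun v => f v - c) U) => //.
exact: differentiableB.
Qed.

(** A point of the hyperplane leaves it when moved slightly in the direction
    [e]. *)
Lemma affine_nonzero_generic (f : W -> K) c e b : (forall x, differentiable f x) ->
  (forall v s, f (v + s *: e) = f v + s) -> generic b [set v | f v - c != 0].
Proof.
move=> df fe.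
have dg x : differentiable (fun v => f v - c) x by apply: differentiableB.
have oA : open [set v | f v - c != 0].
  by rewrite openE => v /= fv; exact: near_neq0.
rewrite /generic; apply: nearW => v.
rewrite (iffLR (interior_id _) oA) => B Bv.
have cB : (v + s *: e) @[s --> (0 : K)] --> v.
  have d0 : differentiable (fun s : K => v + s *: e) 0 by [].
  have /= := differentiable_continuous d0.
  by rewrite /prop_for /continuous_at scale0r addr0.
have [fv|fv] := eqVneq (f v - c) 0; last first.
  by exists v; split => //; exact: (nbhs_singleton Bv).
near (0 : K)^' => s; exists (v + s *: e); split.
  rewrite /= fe addrAC fv add0r.
  by near: s; exact: nbhs_dnbhs_neq.
near: s; exact: (nbhs_dnbhs (cB _ Bv)).
Unshelve. all: by end_near. Qed.

End NormedField.

(** * Theta functions attached to linear forms *)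

Section Holomorphic.
Variables (R : realType) (g : nat).
Local Notation C := (Cplx R).
Local Notation V := 'rV[C]_g.
Implicit Types (a : V) (f h : V -> C).
Local Open Scope classical_set_scope.

Definition holomorphic f : Prop := forall v, differentiable f v.

Lemma holomorphic_near a f : holomorphic f -> holomorphic_at a f.
Proof. by move=> df; apply: (@nearW V _ _ (nbhs_filter a)). Qed.

Lemma holomorphic_atM a f h : holomorphic_at a f -> holomorphic_at a h ->
  holomorphic_at a (fun v => f v * h v).
Proof.
move=> hf hh; rewrite /holomorphic_at.
apply: (@filterS2 V _ (nbhs_filter a)) hf hh => v df dh.
exact: differentiableM.
Qed.

Lemma holomorphic_atV a f : holomorphic f -> f a != 0 ->
  holomorphic_at a (fun v => (f v)^-1).
Proof.
move=> df f0; have n0 := near_neq0 (df a) f0.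
apply: (@filterS V _ (nbhs_filter a)) n0 => v fv.
exact: differentiableV.
Qed.

Lemma holomorphic_at_div a f h : holomorphic_at a f -> holomorphic h ->
  h a != 0 -> holomorphic_at a (fun v => f v / h v).
Proof. by move=> df dh h0; apply: holomorphic_atM => //; apply: holomorphic_atV. Qed.

Lemma eq_germE a f h : eq_germ a f h = generic a [set v | f v = h v].
Proof. by []. Qed.

Lemma unit_at_const1 a f : (forall v, f v = 1) -> unit_at a f.
Proof.
move=> f1; exists (fun => 1); first split.
- by apply: (@nearW V _ _ (nbhs_filter _)) => v; exact: differentiable_cst.
- exact: oner_neq0.
- rewrite eq_germE; apply: generic_near.
  by apply: (@nearW V _ _ (nbhs_filter _)) => v; exact: f1.
Qed.

End Holomorphic.

Section ThetaFamily.
Variables (R : realType) (L : zmodClosed (Cplx R)) (g : nat).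
Local Notation C := (Cplx R).
Local Notation V := 'rV[C]_g.
Local Notation X := 'rV[ring_quotient.Quotient.quot L]_g.
Local Open Scope classical_set_scope.

Definition lattice_vector (w : V) : Prop := forall i, w 0 i \in L.

(** A nonzero linear form on [C^g] that induces a map [E^g -> E].  That it is
    nonzero is expressed by a direction along which it has slope [1]. *)
Record lattice_form := LatticeForm {
  form :> V -> C;
  formD : {morph form : x y / x + y};
  form_differentiable : holomorphic form;
  form_dir : exists e, forall v s, form (v + s *: e) = form v + s;
  form_lattice : forall w, lattice_vector w -> form w \in L }.

Lemma formB (l : lattice_form) : {morph l : x y / x - y}.
Proof. by move=> x y; apply: (addIr (l y)); rewrite -formD !subrK. Qed.

Variables (S kappa : C -> C).
Hypothesis sigma : sigma_function L S kappa.
Variables (I : finType) (l : I -> lattice_form).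
Implicit Types (p : I -> C) (a b v w : V).

(** Local equations of [\sum_k l_k^* (p k)], the sum of the pullbacks of the
    points [p k] of [E] under the maps induced by the forms. *)
Definition local_eq p : cartier_data R g := fun a v =>
  \prod_k (if l k a - p k \in L then l k v - l k a else 1).

Definition theta p v : C := \prod_k S (l k v - p k).

Lemma local_eq_holomorphic p a : holomorphic (local_eq p a).
Proof.
move=> v; apply: differentiable_prod => k; case: (_ \in L).
  apply: differentiableB; first exact: form_differentiable.
  exact: differentiable_cst.
exact: differentiable_cst.
Qed.

Lemma theta_factor_holomorphic (U : C -> C) k c : entire U ->
  holomorphic (fun v => U (l k v - c)).
Proof.
by move=> eU v; exact: (entire_comp_sub c eU (form_differentiable (l k) v)).
Qed.

Lemma theta_holomorphic p : holomorphic (theta p).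
Proof.
move=> v; apply: differentiable_prod => k.
exact: (theta_factor_holomorphic k (p k) (sigma_entire sigma)).
Qed.

Lemma sigma_neq0 u : u \notin L -> S u != 0.
Proof. by case: sigma => _ _ S0 _; apply: contraNneq => /S0. Qed.

(** A factor whose argument at [a] is off the lattice is a unit there; the others
    are the local coordinate times a unit, because [S] has simple zeros. *)
Lemma theta_local p a : exists U : V -> C,
  [/\ holomorphic U, U a != 0 & forall v, theta p v = local_eq p a v * U v].
Proof.
have h k : exists U : V -> C, [/\ holomorphic U, U a != 0 &
    forall v, S (l k v - p k) =
      (if l k a - p k \in L then l k v - l k a else 1) * U v].
  have [kL|kL] := boolP (l k a - p k \in L).
    have [U [eU U0] SU] := sigma_factor sigma kL.
    exists (fun v => U (l k v - p k)); split => //.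
      exact: theta_factor_holomorphic.
    by move=> v; rewrite SU; congr (_ * _); rewrite opprB addrA subrK.
  exists (fun v => S (l k v - p k)); split.
  - exact: (theta_factor_holomorphic k (p k) (sigma_entire sigma)).
  - exact: sigma_neq0.
  - by move=> v; rewrite mul1r.
have [U hU] := choice h.
exists (fun v => \prod_k U k v); split.
- by move=> v; apply: differentiable_prod => k; have [] := hU k.
- by apply/prodf_neq0 => k _; have [] := hU k.
- by move=> v; rewrite -big_split; apply: eq_bigr => k _; have [_ _] := hU k.
Qed.

Lemma local_eq_generic p a b : generic b [set v | local_eq p a v != 0].
Proof.
have gk k : generic b
    [set v | (if l k a - p k \in L then l k v - l k a else 1) != 0].
  case: (_ \in L); last first.
    by apply: generic_near; apply: (@nearW V _ _ (nbhs_filter _)) => v; exact: oner_neq0.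
  have [e he] := form_dir (l k).
  exact: (affine_nonzero_generic _ _ (@form_differentiable (l k)) he).
have := @filter_forall _ _ _ _ (generic_filter b) gk.
by apply: filterS => v h; apply/prodf_neq0 => k _; exact: h.
Qed.

Lemma neq0_generic (f : V -> C) b : holomorphic f -> f b != 0 ->
  generic b [set v | f v != 0].
Proof. by move=> df f0; apply: generic_near; exact: near_neq0 (df b) f0. Qed.

Lemma theta_generic p b : generic b [set v | theta p v != 0].
Proof.
have [U [hU U0 tU]] := theta_local p b.
have := neq0_generic hU U0; have := local_eq_generic p b b.
apply: (@filterS2 _ _ (generic_filter b)) => v l0 u0.
by rewrite /= tU; apply: mulf_neq0.
Qed.

End ThetaFamily.

(** * Translation along a relation between the forms *)

Section ThetaDivisor.
Variables (R : realType) (L : zmodClosed (Cplx R)) (g : nat).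
Local Notation C := (Cplx R).
Local Notation V := 'rV[C]_g.
Local Notation E := (ring_quotient.Quotient.quot L).
Local Notation X := 'rV[E]_g.
Local Open Scope classical_set_scope.
Local Open Scope quotient_scope.
Variables (S kappa : C -> C).
Hypothesis sigma : sigma_function L S kappa.
Variables (I : finType) (l : I -> lattice_form L g).
Implicit Types (p : I -> C) (r : I -> int) (a b v w : V) (x : X).

Lemma tprojP a b : tproj L a = tproj L b <-> lattice_vector L (a - b).
Proof.
split=> [ab i|ab].
  rewrite !mxE (ring_quotient.Quotient.idealrBE L).
  by have /matrixP/(_ 0 i) := ab; rewrite !mxE => ->.
apply/matrixP => i j; rewrite !mxE ord1; apply/eqP.
by rewrite -(ring_quotient.Quotient.idealrBE L); have := ab j; rewrite !mxE.
Qed.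

Definition tlift x : V := \row_i repr (x 0 i).

Lemma tliftK x : tproj L (tlift x) = x.
Proof. by apply/matrixP => i j; rewrite !mxE ord1 reprK. Qed.

Lemma form_mem_tproj k c a b : tproj L a = tproj L b ->
  (l k a - c \in L) = (l k b - c \in L).
Proof.
move=> /tprojP /(form_lattice (l k)); rewrite formB => h.
by rewrite -[l k a](subrK (l k b)) -addrA rpredDl.
Qed.

Lemma local_eq_meromorphic p a : meromorphic_nonzero_at a (local_eq l p a).
Proof.
exists (local_eq l p a), (fun => 1); split.
- exact: (holomorphic_near a (local_eq_holomorphic l p a)).
- by apply: (@nearW V _ _ (nbhs_filter a)) => v; exact: differentiable_cst.
- exact: (generic_nonzero (local_eq_generic l p a a)).
- apply: generic_nonzero; apply: generic_near.
  by apply: (@nearW V _ _ (nbhs_filter a)) => v; exact: oner_neq0.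
- rewrite eq_germE; apply: generic_near.
  by apply: (@nearW V _ _ (nbhs_filter a)) => v /=; rewrite divr1.
Qed.

Lemma local_eq_divisor p : is_divisor L (local_eq l p).
Proof.
split=> [a|a|a b ab].
- exact: local_eq_meromorphic.
- have [U [hU U0 tU]] := theta_local sigma l p a.
  have nU := near_neq0 (hU a) U0.
  apply: (@filterS V _ (nbhs_filter a)) nU => b Ub.
  have [W [hW W0 tW]] := theta_local sigma l p b.
  exists (fun v => W v / U v); first split.
  + exact: holomorphic_at_div (holomorphic_near b hW) hU Ub.
  + by apply: mulf_neq0 => //; rewrite invr_eq0.
  rewrite eq_germE.
  apply: (@filterS2 _ _ (generic_filter b) _ _ _ _ (local_eq_generic l p b b)
                    (neq0_generic hU Ub)) => v lb Uv /=.
  have := tU v; rewrite tW.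
  move: lb Uv => /=.
  move: (local_eq l p a v) (local_eq l p b v) (U v) (W v) => x y u w y0 u0 e.
  apply: (mulIf y0); rewrite divfK //; apply: (mulIf u0).
  by rewrite -e [y * w]mulrC mulrAC divfK.
- exists (fun => 1); first split.
  + by apply: (@nearW V _ _ (nbhs_filter a)) => v; exact: differentiable_cst.
  + exact: oner_neq0.
  rewrite eq_germE; apply: filterS (local_eq_generic l p a a) => v /= l0.
  suff -> : local_eq l p b (v + (b - a)) = local_eq l p a v by rewrite divff.
  apply: eq_bigr => k _; rewrite (form_mem_tproj _ _ ab).
  by rewrite formD formB addrA addrAC addrK.
Qed.

Lemma local_eq_effective p : effective (local_eq l p).
Proof.
move=> a; exists (local_eq l p a).
  exact: (holomorphic_near a (local_eq_holomorphic l p a)).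
by rewrite eq_germE; apply: generic_near; apply: (@nearW V _ _ (nbhs_filter a)).
Qed.

Definition avoids p a := forall k, l k a - p k \notin L.

(** All factors of the local equation are then [1], at every lift of the point. *)
Lemma avoids_support p a : avoids p a -> ~ Defs.support (local_eq l p) (tproj L a).
Proof.
move=> pa [b ba]; apply; apply: unit_at_const1 => v.
rewrite /local_eq big1 // => k _.
by rewrite (form_mem_tproj _ _ ba) (negPf (pa k)).
Qed.

Lemma avoids_theta p a : avoids p a -> theta S l p a != 0.
Proof. by move=> pa; apply/prodf_neq0 => k _; apply: (sigma_neq0 sigma); exact: pa. Qed.

Definition relation r := forall v, \sum_k l k v *~ r k = 0.

Definition translate p r (tau : C) k : C := p k + tau * (r k)%:~R.

(** The part of the multiplier that involves [p] is an exponential in the [p k],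
    whereas [A] comes from the multipliers of [S] alone: this makes the multipliers
    of two families of points comparable. *)
Lemma theta_multiplier w v : lattice_vector L w -> exists2 A : C, A != 0 &
  forall p, theta S l p (v + w) =
    A * cexp (\sum_k kappa (l k w) * (l k v - p k)) * theta S l p v.
Proof.
move=> Lw.
have h k : exists A : C, A != 0 /\
    forall u, S (u + l k w) = A * cexp (kappa (l k w) * u) * S u.
  case: sigma => _ qp _ _.
  by have [A A0 hA] := qp _ (form_lattice (l k) Lw); exists A.
have [A hA] := choice h; exists (\prod_k A k).
  by apply/prodf_neq0 => k _; have [] := hA k.
move=> p; have -> : cexp (\sum_k kappa (l k w) * (l k v - p k)) =
    \prod_k cexp (kappa (l k w) * (l k v - p k)).
  by apply: (big_morph _ (@cexpD R)); exact: cexp0.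
rewrite -!big_split; apply: eq_bigr => k _ /=.
by rewrite formD addrAC; have [_ ->] := hA k.
Qed.

Lemma kappa_relation r w : relation r -> \sum_k kappa (l k w) * (r k)%:~R = 0.
Proof.
case: sigma => kD _ _ _ /(_ w) rw.
have k0 : kappa 0 = 0 by apply: (addrI (kappa 0)); rewrite -kD !addr0.
have kN u : kappa (- u) = - kappa u.
  by apply: (addrI (kappa u)); rewrite -kD !subrr.
have kn u n : kappa (u *+ n) = kappa u *+ n.
  by elim: n => [|n IH]; rewrite ?mulr0n // !mulrS kD IH.
have kz u (n : int) : kappa (u *~ n) = kappa u * n%:~R.
  rewrite mulrzr; case: n => n; first exact: kn.
  by rewrite NegzE !mulrNz kN; congr (- _); exact: kn.
transitivity (kappa (\sum_k l k w *~ r k)); last by rewrite rw k0.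
by rewrite (big_morph kappa kD k0); apply: eq_bigr => k _; rewrite kz.
Qed.

Definition theta_quot p p' x : C :=
  theta S l p' (tlift x) / theta S l p (tlift x).

(** Translating the points along a relation [r] changes the exponent of the
    multiplier by [- tau * \sum_k kappa (l k w) * r k], which is
    [- tau * kappa (\sum_k r k * l k w) = 0].  Both theta functions therefore have the
    same multipliers, and their quotient descends to [E^g]. *)
Lemma theta_quotE p r tau v : relation r ->
  theta_quot p (translate p r tau) (tproj L v) =
  theta S l (translate p r tau) v / theta S l p v.
Proof.
move=> rr; rewrite /theta_quot.
have /tprojP : tproj L (tlift (tproj L v)) = tproj L v by rewrite tliftK.
move: (tlift _) => v' /(theta_multiplier v)[A A0].
rewrite [v + _]addrC subrK; move: (v' - v) => w hA.
rewrite !hA.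
have -> : \sum_k kappa (l k w) * (l k v - translate p r tau k) =
          \sum_k kappa (l k w) * (l k v - p k).
  have e : \sum_k kappa (l k w) * (l k v - translate p r tau k) =
      \sum_k kappa (l k w) * (l k v - p k) -
      tau * \sum_k kappa (l k w) * (r k)%:~R.
    rewrite mulr_sumr -sumrB; apply: eq_bigr => k _.
    by rewrite /translate; ring.
  by rewrite e kappa_relation // mulr0 subr0.
have := cexp_neq0 (\sum_k kappa (l k w) * (l k v - p k)).
move: (cexp _) => c c0.
have Ac : A * c != 0 by apply: mulf_neq0.
by rewrite -mulf_div divff // mul1r.
Qed.

End ThetaDivisor.

(** * Base points and global generation *)

Section Generation.
Variables (R : realType) (L : zmodClosed (Cplx R)) (g : nat).
Local Notation C := (Cplx R).
Local Notation V := 'rV[C]_g.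
Local Notation E := (ring_quotient.Quotient.quot L).
Local Notation X := 'rV[E]_g.
Local Open Scope classical_set_scope.
Variables (S kappa : C -> C).
Hypothesis sigma : sigma_function L S kappa.
Variables (I : finType) (l : I -> lattice_form L g) (r : I -> int).
Hypothesis rel : relation l r.
Hypothesis r0 : forall k, r k != 0.
Implicit Types (p : I -> C) (a b v w : V) (x : X).

Lemma generic3 a (P Q U : set V) (W : V -> Prop) :
  (forall v, P v -> Q v -> U v -> W v) ->
  generic a P -> generic a Q -> generic a U -> generic a W.
Proof.
move=> h gP gQ gU.
by apply: (@filterS3 _ _ (generic_filter a) P Q U).
Qed.

(** The poles of the quotient are cancelled by the local equation of the divisor
    of its denominator. *)
Lemma theta_quot_section p tau : OD_sections (local_eq l p) setT
  (theta_quot S l p (translate p r tau)).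
Proof.
move=> a _; have [U [hU U0 tU]] := theta_local sigma l p a.
exists (fun v => theta S l (translate p r tau) v / U v).
  apply: (holomorphic_at_div _ hU U0).
  exact: (holomorphic_near a (theta_holomorphic sigma l _)).
rewrite eq_germE.
apply: (@filterS2 _ _ (generic_filter a) _ _ _ _ (local_eq_generic l p a a)
                  (neq0_generic hU U0)) => v /= l0 Uv.
rewrite (theta_quotE sigma p tau v rel) tU.
move: (theta S l _ v) (local_eq l p a v) l0 (U v) Uv => t y y0 u u0.
by field; rewrite y0 u0.
Qed.

Lemma translate_linearly_equivalent p tau :
  linearly_equivalent L (local_eq l p) (local_eq l (translate p r tau)).
Proof.
set p' := translate p r tau; exists (theta_quot S l p p'); split => a.
  exists (theta S l p'), (theta S l p); split.
  - exact: (holomorphic_near a (theta_holomorphic sigma l _)).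
  - exact: (holomorphic_near a (theta_holomorphic sigma l _)).
  - exact: (generic_nonzero (theta_generic sigma l p' a)).
  - exact: (generic_nonzero (theta_generic sigma l p a)).
  - rewrite eq_germE; apply: generic_near.
    by apply: (@nearW V _ _ (nbhs_filter a)) => v /=;
       rewrite (theta_quotE sigma p tau v rel).
have [U [hU U0 tU]] := theta_local sigma l p a.
have [U' [hU' U'0 tU']] := theta_local sigma l p' a.
exists (fun v => U v / U' v); first split.
- exact: (holomorphic_at_div (holomorphic_near a hU) hU' U'0).
- by apply: mulf_neq0 => //; rewrite invr_eq0.
rewrite eq_germE; apply: generic3 (theta_generic sigma l p' a)
  (local_eq_generic l p a a) (neq0_generic hU U0) => v /=.
rewrite (theta_quotE sigma p tau v rel) -/p' tU tU'.
move: (local_eq l p a v) (local_eq l p' a v) (U v) (U' v) => y y' u u'.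
rewrite mulf_eq0 negb_or => /andP[y'0 u'0] y0 u0.
by field; rewrite y0 y'0 u0 u'0.
Qed.

Lemma sigma_lattice u : u \in L -> S u = 0.
Proof. by case/(sigma_factor sigma) => U _ ->; rewrite subrr mul0r. Qed.

Lemma near_off_lattice (n : int) (c : C) : n != 0 ->
  \forall tau \near (0 : C)^', c + tau * n%:~R \notin L.
Proof.
move=> n0; have nC : n%:~R != 0 :> C by rewrite intr_eq0.
have near_affine (U : C -> C) : entire U -> U c != 0 ->
    \forall tau \near (0 : C)^', U (c + tau * n%:~R) != 0.
  move=> eU Uc; have h := @entire_affine C U n%:~R c eU 0.
  have := near_neq0 h; rewrite mulr0 add0r => /(_ Uc) nU.
  apply: (@filterS C _ (dnbhs_filter (0 : C))) (nbhs_dnbhs nU) => tau.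
  by rewrite addrC mulrC.
have [cL|cL] := boolP (c \in L); last first.
  have := near_affine S (sigma_entire sigma) (sigma_neq0 sigma cL).
  apply: (@filterS C _ (dnbhs_filter (0 : C))) => tau.
  by apply: contra => /sigma_lattice ->.
have [U [eU Uc] SU] := sigma_factor sigma cL.
apply: (@filterS2 C _ (dnbhs_filter (0 : C))) (near_affine U eU Uc)
  (nbhs_dnbhs_neq (0 : C)) => tau Utau tau0.
apply/negP => /sigma_lattice; rewrite SU addrAC subrr add0r => /eqP.
by apply/negP; apply: mulf_neq0 => //; apply: mulf_neq0.
Qed.

(** As no [r k] vanishes, every component of the divisor moves with [tau], so it
    misses the point [a] as soon as [tau] is small and nonzero. *)
Lemma translate_avoids p a : exists tau, avoids l (translate p r tau) a.
Proof.
have h k : \forall tau \near (0 : C)^', l k a - translate p r tau k \notin L.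
  have rk : - r k != 0 by rewrite oppr_eq0.
  have := near_off_lattice (l k a - p k) rk.
  apply: (@filterS C _ (dnbhs_filter (0 : C))) => tau.
  by rewrite rmorphN mulrN /translate opprD addrA.
have := @filter_forall _ _ _ _ (dnbhs_filter (0 : C)) h.
by move=> /(@filter_ex _ _ (Proper_dnbhs_numFieldType (0 : C)))[tau ht]; exists tau.
Qed.

(** Each point is avoided by an effective divisor of the class, namely by a
    translate along the relation. *)
Theorem local_eq_base_point_free p : base_point_free L (local_eq l p).
Proof.
move=> x; have [tau av] := translate_avoids p (tlift x).
exists (local_eq l (translate p r tau)).
  split.
  - exact: (local_eq_divisor sigma).
  - exact: local_eq_effective.
  - exact: translate_linearly_equivalent.
by rewrite -(tliftK x); exact: avoids_support.
Qed.

(** One section suffices: the quotient of theta functions whose numerator does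
    not vanish at [a] generates the stalk there. *)
Theorem local_eq_globally_generated p : globally_generated L (local_eq l p).
Proof.
move=> a t [h hh th]; have [tau av] := translate_avoids p a.
set p' := translate p r tau in av.
have [U [hU U0 tU]] := theta_local sigma l p a.
have T0 : theta S l p' a != 0 by exact: (avoids_theta sigma).
exists 1%N, (fun _ => theta_quot S l p p'),
  (fun _ v => h v * U v / theta S l p' v).
split.
- by move=> _; exact: theta_quot_section.
- move=> _; apply: (holomorphic_at_div _ (theta_holomorphic sigma l p') T0).
  exact: (holomorphic_atM hh (holomorphic_near a hU)).
rewrite eq_germE; rewrite eq_germE in th.
apply: generic3 (@filterI _ _ (generic_filter a) _ _ th (local_eq_generic l p a a))
  (neq0_generic hU U0) (neq0_generic (theta_holomorphic sigma l p') T0).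
move=> v /= [th_v l0] Uv Tv; rewrite big_ord1 -th_v.
rewrite (theta_quotE sigma p tau v rel) -/p' tU.
move: (t v) (local_eq l p a v) l0 (U v) Uv (theta S l p' v) Tv.
move=> s y y0 u u0 T T_0.
by field; rewrite y0 u0 T_0.
Qed.

End Generation.

(** * Local equations of standard divisors *)

Section NonzeroSums.

(** A single summand must be [delta] itself, while two or more leave room to
    avoid [0]. *)
Lemma nonzero_summands (n : nat) (delta : int) :
  (n = 0%N -> delta = 0) -> (n = 1%N -> delta != 0) ->
  exists2 rho : 'I_n -> int, forall t, rho t != 0 & \sum_t rho t = delta.
Proof.
case: n => [|q] h0 h1.
  by exists (fun _ => 1) => [[]//|]; rewrite big_ord0 h0.
(* Large enough for [delta + K] and its successors to be positive. *)
pose K : int := 1 + `|delta|.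
exists (fun t => if t == ord0 then delta + K *+ q else - K).
  move=> t; case: ifP => _; last by rewrite /K; lia.
  case: q h1 {h0 t} => [|q] h1; first by rewrite mulr0n addr0 h1.
  have : 0 <= K *+ q by rewrite mulrn_wge0 // /K; lia.
  by rewrite mulrS /K; lia.
rewrite big_ord_recl eqxx /= sumr_const card_ord mulNrn.
by rewrite addrK.
Qed.

Lemma abel_telescope (m : nat) (K : pzRingType) (v : 'I_m.+1 -> K) (M : nat -> int) :
  M 0%N = 0 -> M m.+1 = 0 ->
  \sum_(i < m.+1) v i *~ (M i.+1 - M i) +
  \sum_(j < m) (v (fintype.lift ord0 j) - v (widen_ord (leqnSn m) j)) *~ M j.+1
  = 0.
Proof.
move=> M0 Mm.
have -> : \sum_(i < m.+1) v i *~ (M i.+1 - M i) =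
    \sum_(i < m.+1) v i *~ M i.+1 - \sum_(i < m.+1) v i *~ M i.
  by rewrite -sumrB; apply: eq_bigr => i _; rewrite mulrzBr.
have -> : \sum_(j < m) (v (fintype.lift ord0 j) -
      v (widen_ord (leqnSn m) j)) *~ M j.+1 =
    \sum_(j < m) v (fintype.lift ord0 j) *~ M j.+1 -
    \sum_(j < m) v (widen_ord (leqnSn m) j) *~ M j.+1.
  by rewrite -sumrB; apply: eq_bigr => i _; rewrite mulrzBl.
rewrite big_ord_recr /= Mm mulr0z addr0.
rewrite [X in _ - X + _]big_ord_recl /= M0 mulr0z add0r.
by rewrite addrA subrK subrr.
Qed.

End NonzeroSums.

Section EffectivePoints.
Variables (R : realType) (L : zmodClosed (Cplx R)).
Local Notation C := (Cplx R).
Local Notation E := (ring_quotient.Quotient.quot L).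
Local Open Scope quotient_scope.

(** Lifted to [C], the points of the divisor can serve as zeros of theta
    functions. *)
Lemma effective_points (d : {freeg E}) : fgle 0 d ->
  exists P : seq C, (forall x : E, coeff x d = (count (fun c => \pi_E c == x) P)%:Z)
    /\ deg d = (size P)%:Z.
Proof.
move=> /fgposP d0.
pose P := flatten [seq nseq `|coeff x d|%N (repr x : C) | x <- dom d].
exists P; split=> [y|].
  rewrite -[in LHS](freeg_sumE d) raddf_sum /= count_flatten -map_comp sumnE.
  rewrite big_map (big_morph _ PoszD (erefl _)); apply: eq_bigr => x _.
  rewrite coeffU /= count_nseq reprK /= PoszM mulrC gez0_abs //.
  by case: (x == y).
rewrite -[in LHS](freeg_sumE d) raddf_sum /= size_flatten /shape -map_comp sumnE.
rewrite big_map (big_morph _ PoszD (erefl _)); apply: eq_bigr => x _.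
by rewrite degU /= size_nseq gez0_abs.
Qed.

End EffectivePoints.

Section StandardDivisor.
Variables (R : realType) (L : zmodClosed (Cplx R)) (m : nat).
Local Notation C := (Cplx R).
Local Notation E := (ring_quotient.Quotient.quot L).
Local Notation V := 'rV[C]_m.+1.
Local Open Scope quotient_scope.

Lemma coord_holomorphic (i : 'I_m.+1) : holomorphic (fun v : V => v 0 i).
Proof. by move=> v; exact: differentiable_coord. Qed.

Lemma coord_dir (i : 'I_m.+1) :
  exists e : V, forall v s, (v + s *: e) 0 i = v 0 i + s.
Proof. by exists (delta_mx 0 i) => v s; rewrite !mxE !eqxx mulr1. Qed.

Definition coord_form (i : 'I_m.+1) : lattice_form L m.+1.
Proof.
refine (@LatticeForm R L m.+1 (fun v => v 0 i) _ (coord_holomorphic i)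
  (coord_dir i) _).
- by move=> x y; rewrite mxE.
- by move=> w; apply.
Defined.

Lemma diff_holomorphic (i j : 'I_m.+1) :
  holomorphic (fun v : V => v 0 i - v 0 j).
Proof. by move=> v; apply: differentiableB; exact: differentiable_coord. Qed.

Lemma diff_dir (i j : 'I_m.+1) : i != j ->
  exists e : V, forall v s, (v + s *: e) 0 i - (v + s *: e) 0 j = v 0 i - v 0 j + s.
Proof.
move=> ij; exists (delta_mx 0 i) => v s.
by rewrite !mxE !eqxx eq_sym (negPf ij) mulr1 mulr0 addr0 addrAC.
Qed.

Lemma lift_neq_widen (j : 'I_m) : fintype.lift ord0 j != widen_ord (leqnSn m) j.
Proof. by rewrite -val_eqE /= /bump /= add1n neq_ltn ltnSn orbT. Qed.

Definition diff_form (j : 'I_m) : lattice_form L m.+1.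
Proof.
refine (@LatticeForm R L m.+1
  (fun v => v 0 (fintype.lift ord0 j) - v 0 (widen_ord (leqnSn m) j)) _
  (diff_holomorphic _ _) (diff_dir (lift_neq_widen j)) _).
- by move=> x y; rewrite !mxE opprD addrACA.
- by move=> w Lw; rewrite rpredB.
Defined.

Section Equations.
Variables (P : 'I_m.+1 -> seq C) (z : 'I_m -> E).

Definition factor_index : finType := ({i : 'I_m.+1 & 'I_(size (P i))} + 'I_m)%type.

Definition factor_form (k : factor_index) : lattice_form L m.+1 :=
  match k with inl u => coord_form (tag u) | inr j => diff_form j end.

Definition factor_point (k : factor_index) : C :=
  match k with inl u => nth 0 (P (tag u)) (tagged u) | inr j => repr (z j) end.

Lemma std_div_local_eq (d : 'I_m.+1 -> {freeg E}) :
  (forall i x, coeff x (d i) = (count (fun c => \pi_E c == x) (P i))%:Z) ->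
  std_div d z = local_eq factor_form factor_point.
Proof.
move=> dP; apply/funext => a; apply/funext => v.
rewrite /std_div /local_eq big_sumType /=; congr (_ * _).
  transitivity (\prod_i \prod_(t < size (P i))
    (if a 0 i - nth 0 (P i) t \in L then v 0 i - a 0 i else 1)); last first.
    by rewrite sig_big_dep.
  apply: eq_bigr => i _; rewrite /pr_pullback dP -exprnP.
  rewrite -(big_mkord xpredT
     (fun t => if a 0 i - nth 0 (P i) t \in L then v 0 i - a 0 i else 1)).
  rewrite -(big_nth 0 xpredT (fun c => if a 0 i - c \in L then v 0 i - a 0 i else 1)).
  elim: (P i) => [|c s IH]; first by rewrite big_nil.
  rewrite big_cons -IH /= exprD (ring_quotient.Quotient.idealrBE L).
  by rewrite [in RHS]eq_sym; case: eqP => _; rewrite ?expr1.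
apply: eq_bigr => j _; rewrite /Delta_div.
suff -> : (tproj L a \in Delta j (z j)) =
  (a 0 (fintype.lift ord0 j) - a 0 (widen_ord (leqnSn m) j) - repr (z j) \in L).
  by [].
rewrite -addrA -opprD (ring_quotient.Quotient.idealrBE L).
rewrite [\pi_E (_ + repr _)]raddfD /= reprK.
apply/idP/eqP => [|e]; first by rewrite in_setE /Delta /= !mxE.
by apply/mem_set; rewrite /Delta /= !mxE.
Qed.

End Equations.
End StandardDivisor.

(** * A relation between the forms of a standard divisor *)

Section StandardRelation.
Variables (R : realType) (L : zmodClosed (Cplx R)) (m : nat).
Local Notation C := (Cplx R).
Local Notation E := (ring_quotient.Quotient.quot L).
Variable P : 'I_m.+1 -> seq C.
Hypothesis P_deg : forall i : 'I_m.+1,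
  ((i == ord0) + (i == ord_max) <= size (P i))%N.

(** Diagonal [j] joins the coordinates [j.-1] and [j]; there is none for [j = 0]
    and [j = m.+1], so the weights vanish there. *)
Definition diagonal_weight (j : nat) : int :=
  if (j <= m)%N then (\sum_(0 <= i < j) (0 < size (P (inord i))))%N else 0.

Lemma diagonal_weight_gt0 j : (0 < j <= m)%N -> 0 < diagonal_weight j.
Proof.
case/andP=> j0 jm; rewrite /diagonal_weight jm big_ltn //.
have -> : inord 0 = ord0 :> 'I_m.+1 by apply: val_inj; rewrite /= inordK.
by have := P_deg ord0; rewrite eqxx; case: (size _).
Qed.

Lemma diagonal_weightS (i : 'I_m.+1) : (i < m)%N ->
  diagonal_weight i.+1 - diagonal_weight i = (0 < size (P i))%N.
Proof.
move=> im; rewrite /diagonal_weight im ltnW // big_nat_recr //= inord_val.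
by rewrite PoszD addrC addKr.
Qed.

(** Give the [j]-th diagonal the weight [M j] and the [i]-th coordinate the total
    weight [M i.+1 - M i]: by Abel summation the weighted forms add up to [0].  The
    total must be a sum of [size (P i)] nonzero integers, so it has to vanish if
    [P i] is empty, and to be nonzero if [P i] is a single point.  The weights
    [diagonal_weight] increase by one exactly where [P i] is nonempty; they start
    at [0] and are brought back to [0] by the last coordinate, and the conditions
    at both ends hold as [P] is nonempty there, with two points if the ends
    coincide. *)
Lemma standard_relation :
  exists2 r : factor_index P -> int,
    relation (@factor_form R L m P) r & forall k, r k != 0.
Proof.
have h (i : 'I_m.+1) : exists rho : 'I_(size (P i)) -> int,
    (forall t, rho t != 0) /\
    \sum_t rho t = diagonal_weight i.+1 - diagonal_weight i.
  have [im|im] := ltnP i m.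
    have [||rho rho0 rhoE] := @nonzero_summands (size (P i))
      (diagonal_weight i.+1 - diagonal_weight i); last by exists rho.
    - by move=> s0; rewrite diagonal_weightS // s0.
    - by move=> s1; rewrite diagonal_weightS // s1.
  (* At the last coordinate the weight drops to [0] from the positive weight of
     the last diagonal; if [m = 0] there is no diagonal, but [P 0] has at least two points. *)
  have iE : i = ord_max.
    by apply/val_inj/eqP; rewrite eqn_leq im -ltnS ltn_ord.
  have [||rho rho0 rhoE] := @nonzero_summands (size (P i))
      (diagonal_weight i.+1 - diagonal_weight i); last by exists rho.
  - by move=> s0; have := P_deg i; rewrite s0 iE eqxx addn1.
  - move=> s1; have := P_deg i; rewrite s1 {1 2}iE eqxx addn1.
    case: (ord_max == ord0) / eqP => // m0 _.
    rewrite iE /= {1}/diagonal_weight ltnn sub0r oppr_eq0 gt_eqF //.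
    apply: diagonal_weight_gt0; rewrite leqnn andbT lt0n.
    by apply/eqP => m_0; apply: m0; apply: val_inj.
pose rho i := sval (cid (h i)).
have hrho i := svalP (cid (h i)).
exists (fun k : factor_index P => match k with
  | inl u => rho (tag u) (tagged u) | inr j => diagonal_weight j.+1 end).
  move=> v; rewrite big_sumType /=.
  rewrite -[RHS](@abel_telescope m C (fun i => v 0 i) diagonal_weight).
  - congr (_ + _).
    transitivity (\sum_i \sum_(t < size (P i)) v 0 i *~ rho i t).
      by rewrite sig_big_dep.
    apply: eq_bigr => i _; have [_ <-] := hrho i.
    by rewrite -mulrz_sumr.
  - by rewrite /diagonal_weight big_geq.
  - by rewrite /diagonal_weight ltnn.
case=> [u|j]; first exact: (hrho (tag u)).1.
by rewrite gt_eqF //; apply: diagonal_weight_gt0; rewrite ltn_ord.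
Qed.

End StandardRelation.

Lemma standard_divisor_generated (R : realType) (L : zmodClosed (Cplx R))
    (hL : is_lattice L) (m : nat) (n : m.+1.-tuple int)
    (d : 'I_m.+1 -> {freeg curve L}) (z : 'I_m -> curve L) :
  (forall i : 'I_m.+1, 2 <= tnth n i) -> is_standard d -> std_type d = n ->
  base_point_free L (std_div d z) /\ globally_generated L (std_div d z).
Proof.
move=> n2 d0 dn; have [S [kappa sigma]] := sigma_function_exists hL.
have [P hP] := choice (fun i => effective_points (d0 i)).
rewrite (@std_div_local_eq _ _ _ P z d) => [|i x]; last by have [] := hP i.
have P_deg i : ((i == ord0) + (i == ord_max) <= size (P i))%N.
  have := n2 i; rewrite -dn tnth_mktuple; have [_ ->] := hP i.
  by case: (i == ord0); case: (i == ord_max); lia.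
have [r rel r0] := standard_relation L P_deg.
split; first exact: (local_eq_base_point_free sigma rel r0).
exact: (local_eq_globally_generated sigma rel r0).
Qed.

Unset Implicit Arguments.

Theorem proposition4p2 (R : realType) (L : zmodClosed (Cplx R))
    (hL : is_lattice L) :
  (forall (m : nat) (n : m.+1.-tuple int),
     (forall i : 'I_m.+1, 2 <= tnth n i) ->
     forall (d : 'I_m.+1 -> {freeg curve L}) (z : 'I_m -> curve L),
       is_standard d -> std_type d = n ->
       base_point_free L (std_div d z) /\ globally_generated L (std_div d z)) /\
  (forall n k : nat, (1 <= k)%N -> (k < n)%N -> coprime n k ->
     forall (m : nat) (s : m.+1.-tuple int), is_expansion n k s ->
       base_point_free L (cf_div L s) /\ globally_generated L (cf_div L s)).
Proof.
split=> [m n n2 d z|n k _ _ _ m s [_ /all_tnthP s2 _]].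
  exact: standard_divisor_generated.
apply: (standard_divisor_generated hL (n := s)) => //.
- move=> i; apply/fgposP => x; rewrite coeffU mulr_ge0 //.
  by have /= := s2 i; case: (i == ord0); case: (i == ord_max) => /=; lia.
- apply: eq_from_tnth => i; rewrite tnth_mktuple degU; ring.
Qed.
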